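(* Let $n$ take values only in an infinite set of odd square-free integers greater than $1$, and let $r$ be real. Let $J(z)=\sum_{j=1}^{n-1}\left(\frac{j}{n}\right)z^j$ be the character polynomial of degree $n-1$ and define \[ V(z)=\sum_{\substack{0\le j\le n-1\\ \gcd(j,n)>1}} z^j. \] Then \[ \liminf_{n\to\infty}\frac{1}{F(J_r+V_r)}\ge\liminf_{n\to\infty}\frac{1}{F(J_r)}+\liminf_{n\to\infty}\frac{n}{2p_n^3}, \] where $p_n$ is the smallest prime factor of $n$.
   Context: For real $\alpha\ge1$ and $A\in\mathbb{C}[z]$, $\|A\|_\alpha=\left(\frac{1}{2\pi}\int_0^{2\pi}|A(e^{i\theta})|^\alpha d\theta\right)^{1/\alpha}$. The merit factor of $A$ is $F(A)=\frac{\|A\|_2^4}{\|A\|_4^4-\|A\|_2^4}$. For a polynomial $A$ of degree at most $n-1$ (viewed as of length $n$) and real $r$, the rotation is $A_r(z)=z^{-\lfloor nr\rfloor}A(z)\bmod (z^n-1)$. $\left(\frac{\cdot}{n}\right)$ denotes the Jacobi symbol. *)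

(* Defs.v *)
From HB Require Import structures.
From mathcomp Require Import all_boot all_order all_algebra.
From mathcomp Require Import all_classical all_reals all_analysis.

Set Implicit Arguments.
Unset Strict Implicit.
Unset Printing Implicit Defensive.

Import Order.TTheory GRing.Theory Num.Theory.
Import numFieldNormedType.Exports.
Local Open Scope classical_set_scope.
Local Open Scope ring_scope.

Definition legendre (a p : nat) : int :=
  if (p %| a)%N then 0
  else if [exists x : 'I_p, (x * x == a %[mod p])%N] then 1 else -1.

Definition jacobi (a n : nat) : int :=
  \prod_(p <- primes n) (legendre a p) ^+ (logn p n).

Definition squarefree (n : nat) : bool :=
  [forall p : 'I_n.+1, prime p ==> ~~ (p * p %| n)%N].

Section Polys.
Variable R : realType.

Definition charJ (n : nat) : {poly R} :=
  \sum_(1 <= j < n) ((jacobi j n)%:~R *: 'X^j).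

Definition polyV (n : nat) : {poly R} :=
  \sum_(0 <= j < n | (1 < gcdn j n)%N) 'X^j.

(** rotation A_r(z) = z^{-floor(n r)} A(z) mod (z^n - 1), where
    z^{-k} is taken modulo z^n - 1, i.e. as z^{(-k) mod n}. *)
Definition rotp (n : nat) (r : R) (A : {poly R}) : {poly R} :=
  ('X^(`|(- Num.floor (n%:R * r)) %% n|%Z)%N * A) %% ('X^n - 1).

(** |A(e^{i t})| for a polynomial with real coefficients, written out via
    real and imaginary parts. *)
Definition abs_circ (A : {poly R}) (t : R) : R :=
  Num.sqrt ((\sum_(j < size A) A`_j * cos (j%:R * t)) ^+ 2
          + (\sum_(j < size A) A`_j * sin (j%:R * t)) ^+ 2).

Definition Lnorm_circ (alpha : R) (A : {poly R}) : R :=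
  ((2 * pi)^-1 * Rintegral lebesgue_measure `[0, 2 * pi]%classic
       (fun t => abs_circ A t `^ alpha)) `^ alpha^-1.

Definition merit (A : {poly R}) : R :=
  Lnorm_circ 2 A ^+ 4 / (Lnorm_circ 4 A ^+ 4 - Lnorm_circ 2 A ^+ 4).

End Polys.

(* Main.v *)
Require Import Defs.
From HB Require Import structures.
From mathcomp Require Import all_boot all_order all_algebra.
From mathcomp Require Import all_fingroup all_solvable.
From mathcomp Require Import all_classical all_reals all_analysis.
From mathcomp Require Import complex.
From mathcomp Require Import ring lra zify.
Import Order.TTheory GRing.Theory Num.Theory.
Import numFieldNormedType.Exports.
Import Normc.
Local Open Scope classical_set_scope.
Local Open Scope ring_scope.

Set Implicit Arguments.
Unset Strict Implicit.
Unset Printing Implicit Defensive.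

(** Both norms of a polynomial with n coefficients are averages over the 2n-th roots of
    unity. Let p be the least prime factor of the composite n. At the p-th roots of unity
    J vanishes (its Gauss sums vanish at residues not coprime to n), while the values of V
    there sum to n, so that sum |V|^4 >= n^4 / p^3 over these p points: this is where
    n / (2 p^3) comes from.

    At every 2n-th root of unity |J + V|^4 >= |J|^4 - 4 |J|^3 |V|. Gauss sums bound |J| by
    sqrt n at the n-th roots of unity, hence by O(sqrt n log n) at the 2n-th roots by
    interpolation, and sum |J| |V| is controlled by ||J||_2 ||V||_2, where
    ||V||_2^2 = n - phi(n). If n / p^3 is large the p-th roots of unity alone make
    1 / F(J + V) large. Otherwise p >= c n^(1/3), so that (n - phi(n)) / n = O(log n / p)
    beats the logarithms, and phi(n) / n -> 1 makes the normalisations of J and of J + V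
    asymptotically equal. *)

(** * The Jacobi symbol *)

Definition is_square (F : finFieldType) (a : F) := [exists x : F, x * x == a].

(* Both factors are odd powers of a generator of the cyclic group of units. *)
Lemma is_squareM_nonsquare (F : finFieldType) (a b : F) :
  ~~ is_square a -> ~~ is_square b -> is_square (a * b).
Proof.
have [g gP] := cyclicP (field_unit_group_cyclic [set: {unit F}]%G).
have powg (c : F) : c != 0 -> exists i, c = val g ^+ i.
  move=> c0; have cU : c \is a GRing.unit by rewrite unitfE.
  have : FinRing.unit F cU \in <[g]>%g by rewrite -gP inE.
  by move/cycleP => [i ci]; exists i; rewrite -FinRing.val_unitX -ci.
have sq0 : is_square (0 : F) by apply/existsP; exists 0; rewrite mulr0.
have sqE i : ~~ odd i -> is_square (val g ^+ i).
  move=> ei; apply/existsP; exists (val g ^+ i./2).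
  by rewrite -exprD addnn even_halfK.
have oddP c : ~~ is_square c -> exists2 i, odd i & c = val g ^+ i.
  move=> nc; have /powg[i ci] : c != 0 by apply: contraNneq nc => ->.
  by exists i => //; apply: contraNT nc => /sqE; rewrite ci.
move=> /oddP[i oi ->] /oddP[j oj ->]; rewrite -exprD; apply: sqE.
by rewrite oddD oi oj.
Qed.

Lemma is_squareMl (F : finFieldType) (a b : F) :
  a != 0 -> is_square a -> is_square (a * b) = is_square b.
Proof.
move=> a0 /existsP[x /eqP xa]; apply/existsP/existsP => -[y /eqP yb].
- exists (y / x); have x0 : x != 0 by apply: contraNneq a0 => x0; rewrite -xa x0 mul0r.
  by rewrite mulrACA yb -invfM xa mulrAC divff ?mul1r.
- by exists (x * y); rewrite mulrACA xa yb.
Qed.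

(** If every element were a square, squaring would map a finite set onto itself and hence be
    injective, although it identifies [1] and [-1]. *)
Lemma exists_nonsquare (F : finFieldType) :
  (2%:R : F) != 0 -> exists a : F, ~~ is_square a.
Proof.
move=> two0; apply/existsP; apply: contraT; rewrite negb_exists => /forallP sqF.
have surj : #|F| = #|codom (fun x : F => x * x)|.
  apply: eq_card => a; rewrite inE; apply/esym/codomP.
  by have := sqF a; rewrite negbK => /existsP[x /eqP <-]; exists x.
have inj : injective (fun x : F => x * x).
  by apply/injectiveP/card_uniqP; rewrite size_map -cardE -surj.
have /eqP : (1 : F) = -1 by apply: inj; rewrite mulrNN.
by rewrite -subr_eq0 opprK -(natrD _ 1 1) (negPf two0).
Qed.

Lemma natr_Fp_eq (p a b : nat) :
  prime p -> ((a%:R : 'F_p) == b%:R) = (a == b %[mod p]).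
Proof.
move=> pp; apply/eqP/eqP => [/(congr1 val)|e]; first by rewrite /= !val_Fp_nat.
by rewrite -(Fp_nat_mod pp a) e Fp_nat_mod.
Qed.

Lemma natr_Fp_eq0 (p a : nat) : prime p -> ((a%:R : 'F_p) == 0) = (p %| a)%N.
Proof. by move=> pp; rewrite -[0]/(0%:R) natr_Fp_eq // mod0n. Qed.

(** Moves the symbol from residues to the field ['F_p], where its multiplicativity becomes a fact
    about squares. *)
Lemma legendreE (p a : nat) : prime p ->
  legendre a p = if (a%:R : 'F_p) == 0 then 0
                 else if is_square (a%:R : 'F_p) then 1 else -1.
Proof.
move=> pp; rewrite /legendre natr_Fp_eq0 //; case: ifP => // _.
congr (if _ then _ else _); apply/existsP/existsP => -[x /eqP xa].
- by exists x%:R; rewrite -natrM natr_Fp_eq // xa.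
- have xp : (val x < p)%N by have := ltn_ord x; rewrite [X in (_ < X)%N]Fp_cast.
  exists (Ordinal xp) => /=; rewrite -natr_Fp_eq // natrM.
  by rewrite !natr_Zp xa.
Qed.

Lemma legendreM (p a b : nat) : prime p ->
  legendre (a * b) p = legendre a p * legendre b p.
Proof.
move=> pp; rewrite !legendreE // natrM mulf_eq0.
case: eqVneq => [|a0] /=; first by rewrite mul0r.
case: eqVneq => [|b0] /=; first by rewrite mulr0.
have [sa|na] := boolP (is_square (a%:R : 'F_p)); first by rewrite is_squareMl // mul1r.
have [sb|nb] := boolP (is_square (b%:R : 'F_p)).
  by rewrite mulrC is_squareMl // (negPf na) mulr1.
by rewrite is_squareM_nonsquare.
Qed.

Lemma legendre_modn (p n a : nat) : prime p -> (p %| n)%N ->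
  legendre (a %% n) p = legendre a p.
Proof.
move=> pp pn; rewrite !legendreE //.
by have -> : ((a %% n)%:R : 'F_p) = a%:R by apply/eqP; rewrite natr_Fp_eq // modn_dvdm.
Qed.

Lemma legendre1 (p : nat) : prime p -> legendre 1 p = 1.
Proof.
move=> pp; rewrite legendreE // oner_eq0.
by have -> : is_square (1 : 'F_p) by apply/existsP; exists 1; rewrite mulr1.
Qed.

Lemma exists_legendreN1 (p : nat) : prime p -> odd p ->
  exists a, legendre a p = -1.
Proof.
move=> pp op; have [|x nx] := @exists_nonsquare 'F_p.
  by rewrite natr_Fp_eq0 // dvdn_prime2 //; apply: contraTneq op => ->.
exists (val x); rewrite legendreE // natr_Zp (negPf nx) ifF //.
apply: contraNF nx => /eqP ->.
by apply/existsP; exists 0; rewrite mulr0.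
Qed.

Lemma jacobiM (a b n : nat) : jacobi (a * b) n = jacobi a n * jacobi b n.
Proof.
rewrite /jacobi -big_split /= !big_seq; apply: eq_bigr => p.
by rewrite mem_primes => /and3P[pp _ _]; rewrite legendreM // exprMn.
Qed.

Lemma jacobi_modn (a n : nat) : jacobi (a %% n) n = jacobi a n.
Proof.
rewrite /jacobi !big_seq; apply: eq_bigr => p.
by rewrite mem_primes => /and3P[pp _ pn]; rewrite legendre_modn.
Qed.

Lemma jacobi_eq0 (a n : nat) : (0 < n)%N -> ~~ coprime a n -> jacobi a n = 0.
Proof.
move=> n0; rewrite /coprime => nc.
have g0 : (0 < gcdn a n)%N by rewrite gcdn_gt0 n0 orbT.
have /pdivP[q pq qg] : (1 < gcdn a n)%N by rewrite ltn_neqAle eq_sym nc.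
move: qg; rewrite dvdn_gcd => /andP[qa qn].
have qin : q \in primes n by rewrite mem_primes pq n0.
rewrite /jacobi (big_rem q qin) /= {1}/legendre qa expr0n.
by move: qin; rewrite -logn_gt0; case: (logn q n) => //= ?; rewrite mul0r.
Qed.

Lemma jacobi_sqr (a n : nat) : (0 < n)%N -> jacobi a n ^+ 2 = (coprime a n)%:R.
Proof.
move=> n0; have [c|/(jacobi_eq0 n0)->] := boolP (coprime a n); last by rewrite expr0n.
rewrite /jacobi -prodrXl big_seq big1 // => p.
rewrite mem_primes => /and3P[pp _ pn]; rewrite -exprM mulnC exprM /legendre ifF.
  by case: ifP; rewrite ?sqrrN !expr1n.
apply: contraTF c => pa; rewrite /coprime.
apply/negP => /eqP g1; have : (p %| gcdn a n)%N by rewrite dvdn_gcd pa.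
by rewrite g1 dvdn1 => /eqP p1; rewrite p1 in pp.
Qed.

Lemma squarefree_logn (q n : nat) :
  squarefree n -> q \in primes n -> logn q n = 1%N.
Proof.
move=> /forallP sf qn; apply/eqP; rewrite eqn_leq logn_gt0 qn andbT leqNgt.
move: (qn); rewrite mem_primes => /and3P[pq n0 qdn].
have qln : (q < n.+1)%N by rewrite ltnS dvdn_leq.
have := sf (Ordinal qln); rewrite /= pq /= => /negP h.
by apply/negP => l2; apply: h; rewrite -[(q * q)%N]/(q ^ 2)%N pfactor_dvdn.
Qed.

(* Primitivity of the Jacobi character modulo a squarefree odd integer. *)
Lemma exists_jacobiN1 (n q : nat) : odd n -> squarefree n -> q \in primes n ->
  exists u, [/\ jacobi u n = -1, coprime u n & u = 1 %[mod n %/ q]].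
Proof.
move=> on sf qin; move: (qin); rewrite mem_primes => /and3P[pq n0 qn].
have oq : odd q by apply: dvdn_odd on.
have lq := squarefree_logn sf qin.
have nE : n = (q * (n %/ q))%N by rewrite mulnC divnK.
have m0 : (0 < n %/ q)%N by rewrite divn_gt0 ?prime_gt0 //; apply: dvdn_leq.
have cqm : coprime q (n %/ q).
  rewrite prime_coprime //; apply/negP => qm.
  have : (q ^ 2 %| n)%N by rewrite nE expnS expn1 dvdn_pmul2l // prime_gt0.
  by rewrite pfactor_dvdn // lq.
have [b bN] := exists_legendreN1 pq oq.
(* A nonresidue modulo [q] that is [1] modulo the cofactor: only the factor of the Jacobi symbol at
   [q] is then [-1]. *)
pose u := chinese q (n %/ q) b 1.
have uq : u = b %[mod q] by apply: chinese_modl.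
have um : u = 1 %[mod n %/ q] by apply: chinese_modr.
have ju : jacobi u n = -1.
  rewrite /jacobi (big_rem q qin) /= lq expr1.
  have -> : legendre u q = -1.
    by rewrite -(@legendre_modn q q) // uq legendre_modn.
  rewrite big_seq big1 ?mulr1 // => p; rewrite mem_rem_uniq ?primes_uniq // inE.
  rewrite mem_primes => /andP[pq' /and3P[pp _ pn]].
  have pm : (p %| n %/ q)%N.
    move: pn; rewrite {1}nE Euclid_dvdM // => /orP[|//].
    by rewrite dvdn_prime2 // (negPf pq').
  by rewrite -(@legendre_modn p (n %/ q)) // um legendre_modn // legendre1 // expr1n.
exists u; split => //; apply/negPn/negP => /(jacobi_eq0 n0).
by rewrite ju.
Qed.

(** * Roots of unity and exact quadrature *)

Section Modulus.
Variable R : realType.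
Implicit Types (z w : R[i]) (P Q : {poly R}).

Lemma normc_ge0 z : 0 <= normc z.
Proof. by case: z => a b /=; exact: sqrtr_ge0. Qed.

Lemma normcD_le z w : normc (z + w) <= normc z + normc w.
Proof. exact: le_normcD. Qed.

Lemma normc_sum_le (I : Type) (s : seq I) (P : pred I) (F : I -> R[i]) :
  normc (\sum_(i <- s | P i) F i) <= \sum_(i <- s | P i) normc (F i).
Proof.
elim/big_rec2: _ => [|i x z _ le_zx]; first by rewrite normc0.
by apply: le_trans (normcD_le _ _) _; rewrite lerD2l.
Qed.

Lemma normcX z n : normc (z ^+ n) = normc z ^+ n.
Proof. by elim: n => [|n IH]; rewrite ?expr0 ?normc1 // !exprS normcM IH. Qed.

Lemma normc_real (x : R) : normc (x%:C)%C = `|x|.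
Proof. by rewrite /= expr0n addr0 sqrtr_sqr. Qed.

Lemma normc_nat n : normc (n%:R : R[i]) = n%:R.
Proof. by rewrite -(rmorph_nat (real_complex R)) normc_real ger0_norm. Qed.

Lemma normc_sqrE z : normc z ^+ 2 = complex.Re z ^+ 2 + complex.Im z ^+ 2.
Proof. by case: z => a b; rewrite /= sqr_sqrtr // addr_ge0 ?sqr_ge0. Qed.

Lemma Re_sum (I : Type) (s : seq I) (P : pred I) (F : I -> R[i]) :
  complex.Re (\sum_(i <- s | P i) F i) = \sum_(i <- s | P i) complex.Re (F i).
Proof. by apply: (big_morph (@complex.Re R)) => // -[a b] [c d]. Qed.

Lemma Im_sum (I : Type) (s : seq I) (P : pred I) (F : I -> R[i]) :
  complex.Im (\sum_(i <- s | P i) F i) = \sum_(i <- s | P i) complex.Im (F i).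
Proof. by apply: (big_morph (@complex.Im R)) => // -[a b] [c d]. Qed.

Definition expi (t : R) : R[i] := (cos t +i* sin t)%C.

Lemma expi0 : expi 0 = 1.
Proof. by rewrite /expi cos0 sin0. Qed.

Lemma expiD s t : expi (s + t) = expi s * expi t.
Proof.
rewrite /expi cosD sinD; apply/eqP; rewrite eq_complex /= eqxx /=.
by rewrite addrC.
Qed.

Lemma expi_mulrn t n : expi (n%:R * t) = expi t ^+ n.
Proof.
elim: n => [|n IH]; first by rewrite mul0r expi0.
by rewrite exprS -IH -expiD -natr1 mulrDl mul1r addrC.
Qed.

Lemma normc_expi t : normc (expi t) = 1.
Proof. by rewrite /= cos2Dsin2 sqrtr1. Qed.

Lemma expi_2pi : expi (2 * pi) = 1.
Proof. by rewrite /expi mulr_natl cos2pi sin2pi. Qed.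

(** The real part is [1 - 2 sin(t/2)^2], and [sin(t/2) > 0] on this range. *)
Lemma expi_neq1 t : 0 < t < 2 * pi -> expi t != 1.
Proof.
move=> /andP[t0 t2]; rewrite eq_complex /= negb_and; apply/orP; left.
have -> : t = (t / 2) *+ 2 by rewrite -mulr_natr divfK.
rewrite cos_mulr2n -subr_eq0.
have s0 : 0 < sin (t / 2) by apply: sin_gt0_pi; lra.
have := cos2Dsin2 (t / 2); have := mulr_gt0 s0 s0; rewrite -expr2 => h1 h2.
by apply/negP => /eqP; rewrite -mulr_natr; lra.
Qed.

Definition node (N k : nat) : R := k%:R * (2 * pi / N%:R).

Definition uroot (N : nat) : R[i] := expi (2 * pi / N%:R).

Lemma expi_node N k : expi (node N k) = uroot N ^+ k.
Proof. exact: expi_mulrn. Qed.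

Lemma uroot_prim N : (0 < N)%N -> N.-primitive_root (uroot N).
Proof.
move=> N0; have N0' : (0 : R) < N%:R by rewrite ltr0n.
apply/andP; split => //; apply/forallP => i; rewrite unity_rootE -expi_mulrn.
apply/eqP; case: (ltngtP i.+1 N) (ltn_ord i) => // [iN|iN] _.
- apply/negbTE/expi_neq1.
  have pi0 := pi_gt0 R.
  rewrite mulr_gt0 ?divr_gt0 ?mulr_gt0 ?ltr0n //= mulrA ltr_pdivrMr //.
  by rewrite mulrC ltr_pM2l ?mulr_gt0 // ltr_nat.
- by rewrite iN mulrC divfK ?lt0r_neq0 // expi_2pi eqxx.
Qed.

Lemma uroot_dvd (m N : nat) : (0 < N)%N -> (m %| N)%N ->
  uroot N ^+ (N %/ m) = uroot m.
Proof.
move=> N0 mN; have m0 := dvdn_gt0 N0 mN; rewrite /uroot -expi_mulrn; congr expi.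
have NE : (N%:R : R) = (N %/ m)%:R * m%:R by rewrite -natrM divnK.
have q0 : ((N %/ m)%:R : R) != 0 by rewrite pnatr_eq0 -lt0n divn_gt0 // dvdn_leq.
have m0' : (m%:R : R) != 0 by rewrite pnatr_eq0 -lt0n.
by rewrite NE; field; rewrite q0 m0'.
Qed.

Lemma normc_uroot N k : normc (uroot N ^+ k) = 1.
Proof. by rewrite normcX normc_expi expr1n. Qed.

End Modulus.

(** Multiplied by [z ^+ m - 1], the geometric sum telescopes to [0]. This orthogonality relation
    underlies the quadrature, the interpolation formula and the lower bound for V at the p-th roots
    of unity. *)
Lemma sum_prim_root (F : fieldType) (z : F) (N m : nat) :
  N.-primitive_root z ->
  \sum_(k < N) (z ^+ m) ^+ k = if (N %| m)%N then N%:R else 0.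
Proof.
move=> zN; rewrite (prim_order_dvd zN); case: eqVneq => [->|z1].
  by under eq_bigr do rewrite expr1n; rewrite sumr_const card_ord.
apply: (mulfI (x := z ^+ m - 1)); first by rewrite subr_eq0.
by rewrite -subrX1 mulr0 -exprM mulnC exprM (prim_expr_order zN) expr1n subrr.
Qed.

(** * Equidistant quadrature of trigonometric polynomials, and the norms as finite sums *)

Section Quadrature.
Variable R : realType.
Implicit Types (P Q : {poly R}) (f g : R -> R).

(** The hypotheses say that [|a - b| < N], so [N] divides [a - b] only when [a = b]: there is no
    aliasing. *)
Lemma sum_cos_node (N a b : nat) : (a < b + N)%N -> (b < a + N)%N ->
  \sum_(k < N) cos ((a%:R - b%:R) * node R N k) = (N * (a == b))%:R.
Proof.
wlog le_ba : a b / (b <= a)%N.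
  move=> H ab ba; have [/H|/ltnW le_ab] := leqP b a; first exact.
  rewrite eq_sym -(H b a) //; apply: eq_bigr => k _.
  by rewrite -cosN -mulNr opprB.
move=> abN _.
have N0 : (0 < N)%N by lia.
have := @sum_prim_root _ (uroot R N) N (a - b) (uroot_prim R N0).
move/(congr1 (@complex.Re R)); rewrite Re_sum => eS.
transitivity (\sum_(k < N) complex.Re ((uroot R N ^+ (a - b)) ^+ k)).
  apply: eq_bigr => k _; rewrite -exprM mulnC exprM -expi_node -expi_mulrn.
  by rewrite /expi /= natrB.
rewrite eS; case: eqVneq => [->|neq_ab].
  by rewrite subnn dvdn0 muln1 -(rmorph_nat (real_complex R)).
by rewrite muln0 gtnNdvd //; lia.
Qed.

Lemma is_derive_sinZ (c x : R) : c != 0 ->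
  is_derive x 1 (fun t => c^-1 * sin (c * t) : R) (cos (c * x)).
Proof.
move=> c0.
have h : is_derive x 1 ( *%R c : R -> R) c.
  by apply: is_derive_eq; rewrite /GRing.scale /= mulr1.
have h2 := @is_derive1_comp R sin ( *%R c) x (cos (c * x)) c (is_derive_sin _) h.
have h3 := @is_deriveZ _ _ _ (sin \o *%R c) c^-1 x 1 _ h2.
by apply: (is_derive_eq h3); rewrite /GRing.scale /=; field.
Qed.

Lemma continuous_cosZ (c : R) : continuous (fun t : R => cos (c * t) : R).
Proof.
move=> x; apply: continuous_comp; last exact: continuous_cos.
by apply: cvgM; [exact: cvg_cst|exact: cvg_id].
Qed.

Lemma integrable_cosZ (c a b : R) :
  lebesgue_measure.-integrable `[a, b]%classic (EFin \o (fun t : R => cos (c * t))).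
Proof.
apply: continuous_compact_integrable; first exact: segment_compact.
by apply: continuous_subspaceT; exact: continuous_cosZ.
Qed.

Lemma Rintegral_cos (a b : nat) :
  Rintegral lebesgue_measure `[0, 2 * pi]%classic
    (fun t : R => cos ((a%:R - b%:R) * t)) = 2 * pi * (a == b)%:R.
Proof.
have pi0 : (0 : R) < 2 * pi by rewrite mulr_gt0 ?pi_gt0.
rewrite /Rintegral; case: eqVneq => [->|neq_ab].
  under eq_integral do rewrite subrr mul0r cos0.
  rewrite integral_cst //= lebesgue_measure_itv /= lte_fin pi0 mul1e.
  by rewrite oppr0 adde0 mulr1.
have c0 : (a%:R - b%:R : R) != 0 by rewrite subr_eq0 eqr_nat.
set c := a%:R - b%:R in c0 *.
have cF : continuous (fun t => c^-1 * sin (c * t) : R).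
  move=> x; apply: differentiable_continuous; apply/derivable1_diffP.
  exact: (@ex_derive _ _ _ _ _ _ _ (is_derive_sinZ x c0)).
rewrite (@continuous_FTC2 _ _ (fun t => c^-1 * sin (c * t)) 0 (2 * pi)) //.
- rewrite mulr0 sin0 mulr0 sube0 /=.
  have -> : c * (2 * pi) = a%:R * (2 * pi) - b%:R * (2 * pi) by rewrite -mulrBl.
  have s0 k : sin (k%:R * (2 * pi) : R) = 0.
    by have := expi_mulrn (2 * pi : R) k; rewrite expi_2pi expr1n => -[].
  by rewrite sinB !s0 mul0r mulr0 subrr mulr0 mulr0.
- by apply: continuous_subspaceT; exact: continuous_cosZ.
- split; first by move=> x _; exact: (@ex_derive _ _ _ _ _ _ _ (is_derive_sinZ x c0)).
  + by apply: cvg_at_right_filter; exact: cF.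
  + by apply: cvg_at_left_filter; exact: cF.
- move=> x _; rewrite derive1E.
  exact: (@derive_val _ _ _ _ _ _ _ (is_derive_sinZ x c0)).
Qed.

(** Integrability is carried along because linearity of the integral requires it; the predicate is
    then closed under linear combinations of cosines. *)
Definition quad_exact (N : nat) f :=
  lebesgue_measure.-integrable `[0, 2 * pi : R]%classic (EFin \o f) /\
  (2 * pi)^-1 * Rintegral lebesgue_measure `[0, 2 * pi]%classic f
    = N%:R^-1 * \sum_(k < N) f (node R N k).

Lemma quad_exact_cos (N a b : nat) : (a < b + N)%N -> (b < a + N)%N ->
  quad_exact N (fun t => cos ((a%:R - b%:R) * t)).
Proof.
move=> ab ba; split; first exact: integrable_cosZ.
have N0 : (N%:R : R) != 0 by rewrite pnatr_eq0; lia.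
have pi0 : (2 * pi : R) != 0 by rewrite mulf_neq0 ?pnatr_eq0 // gt_eqF ?pi_gt0.
by rewrite Rintegral_cos sum_cos_node // natrM !mulKf.
Qed.

Lemma quad_exactZ N c f : quad_exact N f -> quad_exact N (fun t => c * f t).
Proof.
move=> [If Ef]; split; first by (apply: eq_integrable (integrableZl _ c If) => // t _; rewrite /= EFinM).
by rewrite RintegralZl // mulrCA Ef mulrCA mulr_sumr.
Qed.

Lemma quad_exactD N f g :
  quad_exact N f -> quad_exact N g -> quad_exact N (fun t => f t + g t).
Proof.
move=> [If Ef] [Ig Eg]; split.
  by apply: eq_integrable (integrableD _ If Ig) => // t _; rewrite /= EFinD.
by rewrite RintegralD // mulrDr Ef Eg -mulrDr big_split.
Qed.

Lemma quad_exact_ext N f g : f =1 g -> quad_exact N f -> quad_exact N g.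
Proof. by move=> /funext ->. Qed.

Lemma quad_exact_sum N (I : Type) (s : seq I) (F : I -> R -> R) :
  (forall i, quad_exact N (F i)) -> quad_exact N (fun t => \sum_(i <- s) F i t).
Proof.
move=> HF; elim: s => [|i s IH].
  apply: (@quad_exact_ext N (fun t => 0 * 0)).
    by move=> t; rewrite big_nil mul0r.
  split; first by rewrite mul0r; exact: integrable0.
  by rewrite mul0r /Rintegral integral0 mulr0 big1 ?mulr0.
apply: quad_exact_ext (quad_exactD (HF i) IH) => t.
by rewrite big_cons.
Qed.

Definition cpoly P : {poly R[i]} := map_poly (real_complex R) P.

Lemma horner_cpoly P n z : (size P <= n)%N ->
  (cpoly P).[z] = \sum_(j < n) (P`_j)%:C%C * z ^+ j.
Proof.
move=> sP; rewrite (@horner_coef_wide _ n) ?size_map_poly //.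
by apply: eq_bigr => j _; rewrite coef_map.
Qed.

Lemma Re_horner_expi P n t : (size P <= n)%N ->
  complex.Re (cpoly P).[expi t] = \sum_(j < n) P`_j * cos (j%:R * t).
Proof.
move=> sP; rewrite (horner_cpoly _ sP) Re_sum; apply: eq_bigr => j _.
by rewrite -expi_mulrn /= mul0r subr0.
Qed.

Lemma Im_horner_expi P n t : (size P <= n)%N ->
  complex.Im (cpoly P).[expi t] = \sum_(j < n) P`_j * sin (j%:R * t).
Proof.
move=> sP; rewrite (horner_cpoly _ sP) Im_sum; apply: eq_bigr => j _.
by rewrite -expi_mulrn /= mul0r addr0.
Qed.

Lemma abs_circE P t : abs_circ P t = normc (cpoly P).[expi t].
Proof.
rewrite /abs_circ -(@Re_horner_expi P (size P)) // -(@Im_horner_expi P (size P)) //.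
by case: _.[_].
Qed.

Lemma sqr_abs_circ P n t : (size P <= n)%N ->
  abs_circ P t ^+ 2 =
    \sum_(i < n) \sum_(j < n) P`_i * P`_j * cos ((i%:R - j%:R) * t).
Proof.
move=> sP; rewrite abs_circE normc_sqrE (Re_horner_expi _ sP) (Im_horner_expi _ sP).
rewrite !expr2 !mulr_suml -big_split; apply: eq_bigr => i _ /=.
rewrite !mulr_sumr -big_split; apply: eq_bigr => j _ /=.
by rewrite mulrBl cosB; ring.
Qed.

Lemma quad_exact_sqr_abs P n N : (size P <= n)%N -> (n <= N)%N ->
  quad_exact N (fun t => abs_circ P t ^+ 2).
Proof.
move=> sP nN; apply: (quad_exact_ext (fun t => esym (sqr_abs_circ t sP))).
apply: quad_exact_sum => i; apply: quad_exact_sum => j; apply: quad_exactZ.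
by apply: quad_exact_cos; have := ltn_ord i; have := ltn_ord j; lia.
Qed.

(** The fourth power has frequencies [i + k - j - l], of absolute value at most [2n - 2], so [2n]
    nodes suffice. *)
Lemma quad_exact_abs4 P n : (size P <= n)%N ->
  quad_exact (n + n) (fun t => abs_circ P t ^+ 4).
Proof.
move=> sP.
apply: (@quad_exact_ext _ (fun t => \sum_(i < n) \sum_(j < n) \sum_(k < n) \sum_(l < n)
   (P`_i * P`_j * (P`_k * P`_l) / 2) *
   (cos (((i + k)%:R - (j + l)%:R) * t) + cos (((i + l)%:R - (j + k)%:R) * t)))).
  move=> t; rewrite -[4%N]/(2 * 2)%N exprM [RHS]expr2 (sqr_abs_circ _ sP).
  rewrite mulr_suml; apply: eq_bigr => i _; rewrite mulr_suml; apply: eq_bigr => j _.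
  rewrite mulr_sumr; apply: eq_bigr => k _; rewrite mulr_sumr; apply: eq_bigr => l _.
  have -> : ((i + k)%:R - (j + l)%:R) * t = (i%:R - j%:R) * t + (k%:R - l%:R) * t.
    by rewrite !natrD; ring.
  have -> : ((i + l)%:R - (j + k)%:R) * t = (i%:R - j%:R) * t - (k%:R - l%:R) * t.
    by rewrite !natrD; ring.
  by rewrite cosD cosB; field.
apply: quad_exact_sum => -[i /= ltin]; apply: quad_exact_sum => -[j /= ltjn].
apply: quad_exact_sum => -[k /= ltkn]; apply: quad_exact_sum => -[l /= ltln].
by apply/quad_exactZ/quad_exactD; apply: quad_exact_cos; lia.
Qed.

Lemma parseval P N : (size P <= N)%N ->
  \sum_(k < N) abs_circ P (node R N k) ^+ 2 = N%:R * \sum_(j < N) P`_j ^+ 2.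
Proof.
move=> sP; under eq_bigr do rewrite (sqr_abs_circ _ sP).
rewrite exchange_big mulr_sumr; apply: eq_bigr => i _ /=.
rewrite exchange_big (bigD1 i) //= -mulr_sumr sum_cos_node; try by have := ltn_ord i; lia.
rewrite eqxx muln1 big1 ?addr0 => [|j ji]; first by rewrite mulrC expr2.
rewrite -mulr_sumr sum_cos_node; try by have := ltn_ord i; have := ltn_ord j; lia.
by rewrite eq_sym -val_eqE in ji; rewrite (negPf ji) muln0 mulr0.
Qed.

Lemma abs_circ_ge0 P t : 0 <= abs_circ P t.
Proof. exact: sqrtr_ge0. Qed.

Lemma mean_ge0 (N : nat) f : (forall t, 0 <= f t) ->
  0 <= N%:R^-1 * \sum_(k < N) f (node R N k).
Proof. by move=> f0; rewrite mulr_ge0 ?invr_ge0 // sumr_ge0. Qed.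

Lemma Lnorm_circ2 P n : (0 < n)%N -> (size P <= n)%N ->
  Lnorm_circ 2 P ^+ 2 = \sum_(j < n) P`_j ^+ 2.
Proof.
move=> n0 sP; have [_] := quad_exact_sqr_abs sP (leqnn n).
rewrite parseval // mulKf ?pnatr_eq0 -?lt0n // => h.
rewrite /Lnorm_circ.
have -> : (fun t => abs_circ P t `^ 2) = (fun t => abs_circ P t ^+ 2).
  by apply/funext => t; rewrite powR_mulrn ?abs_circ_ge0.
by rewrite h -powR_mulrn ?powR_ge0 // -powRrM mulVf ?pnatr_eq0 // powRr1 //
  sumr_ge0 // => j _; exact: sqr_ge0.
Qed.

Lemma Lnorm_circ4 P n : (size P <= n)%N ->
  Lnorm_circ 4 P ^+ 4 =
    (n + n)%:R^-1 * \sum_(k < n + n) abs_circ P (node R (n + n) k) ^+ 4.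
Proof.
move=> sP; have [_ h] := quad_exact_abs4 sP.
rewrite /Lnorm_circ.
have -> : (fun t => abs_circ P t `^ 4) = (fun t => abs_circ P t ^+ 4).
  by apply/funext => t; rewrite powR_mulrn ?abs_circ_ge0.
rewrite h -powR_mulrn ?powR_ge0 // -powRrM mulVf ?pnatr_eq0 // powRr1 //.
by apply: (@mean_ge0 _ (fun t => abs_circ P t ^+ 4)) => t; rewrite exprn_ge0 ?abs_circ_ge0.
Qed.

Lemma invr_merit P n (s : R) : (size P <= n)%N ->
  \sum_(j < n) P`_j ^+ 2 = s -> 0 < s ->
  (merit P)^-1 =
    ((n + n)%:R^-1 * \sum_(k < n + n) abs_circ P (node R (n + n) k) ^+ 4) / s ^+ 2 - 1.
Proof.
move=> sP <- s0.
have n0 : (0 < n)%N by case: n s0 {sP} => //; rewrite big_ord0 ltxx.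
have e2 : Lnorm_circ 2 P ^+ 4 = (\sum_(j < n) P`_j ^+ 2) ^+ 2.
  by rewrite -(Lnorm_circ2 n0 sP) -exprM.
have e4 := Lnorm_circ4 sP.
(* Here [x] and [y] are the fourth powers of the two norms. If [y = x], inversion of zero gives zero
   and both sides are [0]. *)
suff H (x y v : R) : x = v -> v != 0 -> (x / (y - x))^-1 = y / v - 1.
  by rewrite -e4; apply: H e2 _; rewrite expf_neq0 // gt_eqF.
by move=> -> v0; rewrite invf_div mulrBl divff.
Qed.

End Quadrature.

(** * Interpolation at the n-th roots of -1 *)

Section Interpolation.
Variable R : realType.
Implicit Types (z w : R[i]) (P Q : {poly R}).

(** Discrete Fourier inversion: the coefficients are recovered from the values at the n-th roots of
    unity. The exponent [n - k] stands for [-k]. *)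
Lemma horner_interpolation P n z : (0 < n)%N -> (size P <= n)%N ->
  n%:R * (cpoly P).[z] =
  \sum_(k < n) (cpoly P).[uroot R n ^+ k] * \sum_(j < n) (z * uroot R n ^+ (n - k)) ^+ j.
Proof.
move=> n0 sP; set e := uroot R n; have pe : n.-primitive_root e by exact: uroot_prim.
rewrite (horner_cpoly z sP).
under [RHS]eq_bigr => k _.
  rewrite (horner_cpoly _ sP) mulr_suml.
  under eq_bigr => i _.
    rewrite mulr_sumr; under eq_bigr => j _.
      have -> : (P`_i)%:C%C * (e ^+ k) ^+ i * (z * e ^+ (n - k)) ^+ j
        = (P`_i)%:C%C * z ^+ j * (e ^+ (i + (n - j))) ^+ k.
        rewrite exprMn -!exprM mulrACA -exprD; congr (_ * _).
        (* Adding [k * j] turns both exponents into [k * i] plus a multiple of [n]. *)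
        apply/eqP; rewrite (eq_prim_root_expr pe) -(eqn_modDr (k * j)).
        have -> : (k * i + (n - k) * j + k * j = j * n + k * i)%N.
          by rewrite -addnA -mulnDl subnK 1?ltnW // addnC mulnC.
        have -> : ((i + (n - j)) * k + k * j = k * n + k * i)%N.
          by rewrite [(k * j)%N]mulnC -mulnDl -addnA subnK 1?ltnW // addnC mulnC mulnDr.
        by rewrite !modnMDl.
      over.
    over.
  over.
rewrite exchange_big mulr_sumr; apply: eq_bigr => i _ /=.
rewrite exchange_big (bigD1 i) //= -mulr_sumr (sum_prim_root _ pe).
rewrite subnKC 1?ltnW // dvdnn big1 ?addr0 => [|j ji].
  by rewrite mulrC.
rewrite -mulr_sumr (sum_prim_root _ pe) ifF ?mulr0 //.
apply/negbTE; apply: contra ji => h; apply/eqP/val_inj => /=.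
have := ltn_ord i; have := ltn_ord j => jn iN.
have : (i + (n - j) = n)%N; last by lia.
case/dvdnP: h => q hq; have : (q = 1)%N by nia.
by move=> q1; rewrite hq q1 mul1n.
Qed.

(** The quotient of [1 - w ^+ j] by [1 - w] is a sum of [j] terms of modulus 1. *)
Lemma normc_1BX_le w j : normc w = 1 -> normc (1 - w ^+ j) <= j%:R * normc (1 - w).
Proof.
move=> w1; rewrite -opprB normcN subrX1 normcM -[normc (1 - w)]normcN opprB mulrC.
apply: ler_wpM2r; first exact: normc_ge0.
apply: le_trans (normc_sum_le _ _ _) _.
by under eq_bigr do rewrite normcX w1 expr1n; rewrite sumr_const card_ord.
Qed.

Lemma cos_le0 (x : R) : pi / 2 <= x <= pi + pi / 2 -> cos x <= 0.
Proof.
move=> h; have : 0 <= cos (x - pi) by apply: cos_ge0_pihalf; lra.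
by rewrite cosB cospi sinpi mulr0 addr0 mulrN1 oppr_ge0.
Qed.

Lemma normc_1Bexpi_ge1 (x : R) : pi / 2 <= x <= pi + pi / 2 -> 1 <= normc (1 - expi x).
Proof.
move=> /cos_le0 c0; rewrite -(ler_pXn2r (n := 2)) ?nnegrE ?normc_ge0 // normc_sqrE /=.
have := cos2Dsin2 x; rewrite sub0r sqrrN sqrrB; lra.
Qed.

(* If 0 < l <= N/2 and j = floor(N/(4l)) + 1 then w ^+ j lies in the left half-plane,
   so that 1 <= |1 - w ^+ j| <= j |1 - w|. *)
Lemma normc_1Buroot_half (N l : nat) : (0 < l)%N -> (l + l <= N)%N ->
  (normc (1 - uroot R N ^+ l))^-1 <= N%:R / l%:R.
Proof.
move=> l0 lN; pose j := (N %/ (4 * l)).+1.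
have N0 : (0 < N)%N by lia.
have N0' : (0 : R) < N%:R by rewrite ltr0n.
(* [h1] and [h2] put the angle [2 pi j l / N] between [pi / 2] and [3 pi / 2]; [h3] turns the factor
   [j] into [N / l]. *)
have [h1 h2 h3] : [/\ (N <= 4 * (j * l))%N, (4 * (j * l) <= 3 * N)%N & (j * l <= N)%N].
  have := divn_eq N (4 * l); have : (N %% (4 * l) < 4 * l)%N by rewrite ltn_mod; lia.
  by rewrite /j; move: (N %/ (4 * l))%N (N %% (4 * l))%N => q r; split; nia.
have j1 : 1 <= normc (1 - (uroot R N ^+ l) ^+ j).
  rewrite -exprM -expi_node mulnC; apply: normc_1Bexpi_ge1.
  have pi0 := pi_gt0 R; rewrite /node mulrA.
  move: h1 h2; rewrite -!(ler_nat R) [(4 * (j * l))%:R]natrM [(3 * N)%:R]natrM => h1 h2.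
  by rewrite ler_pdivlMr // ler_pdivrMr //; apply/andP; split; nra.
have := normc_1BX_le j (normc_uroot R N l).
set x := normc _ in j1 *; set y := normc _ => xy.
have jl0 : (0 : R) < j%:R by rewrite ltr0n.
have y0 : 0 < y by rewrite -(pmulr_rgt0 _ jl0); lra.
rewrite ler_pdivlMr ?ltr0n // mulrC ler_pdivrMr //.
have : (j%:R * l%:R : R) <= N%:R by rewrite -natrM ler_nat.
have : (0 : R) < l%:R by rewrite ltr0n.
nra.
Qed.

(** The modulus is invariant under [l -> N - l], and one of the two is at most [N / 2]. Adding both
    bounds avoids a case split when summing. *)
Lemma normc_1Buroot (N l : nat) : (0 < l < N)%N ->
  (normc (1 - uroot R N ^+ l))^-1 <= N%:R * (l%:R^-1 + (N - l)%:R^-1).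
Proof.
move=> /andP[l0 lN].
have [h|h] := leqP (l + l) N.
  apply: le_trans (normc_1Buroot_half l0 h) _.
  by rewrite ler_wpM2l // lerDl invr_ge0.
have -> : normc (1 - uroot R N ^+ l) = normc (1 - uroot R N ^+ (N - l)).
  rewrite -[LHS]mul1r -(normc_uroot R N (N - l)) -normcM mulrBr mulr1 -exprD.
  rewrite subnK 1?ltnW // (prim_expr_order (uroot_prim R _)); last by lia.
  by rewrite -normcN opprB.
apply: le_trans (normc_1Buroot_half _ _) _; try lia.
by rewrite ler_wpM2l // lerDr invr_ge0.
Qed.

Definition harmonic_sum (N : nat) : R := \sum_(1 <= l < N) l%:R^-1.

Lemma sum_normc_1Buroot (N : nat) : (0 < N)%N ->
  \sum_(l < N | l != 0%N :> nat) (normc (1 - uroot R N ^+ l))^-1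
    <= N%:R * (harmonic_sum N *+ 2).
Proof.
move=> N0; rewrite -(big_mkord (fun l => l != 0%N)
  (fun l => (normc (1 - uroot R N ^+ l))^-1)) big_ltn_cond //=.
have -> : N%:R * (harmonic_sum N *+ 2)
    = \sum_(1 <= i < N) N%:R * (i%:R^-1 + (N - i)%:R^-1).
  rewrite mulr2n -mulr_sumr big_split /=; congr (_ * (_ + _)).
  by rewrite /harmonic_sum big_nat_rev; apply: eq_bigr => i _; rewrite add1n subSS.
rewrite big_nat_cond [X in _ <= X]big_nat_cond.
rewrite [X in X <= _](eq_bigl (fun i => (1 <= i < N)%N && true)); last first.
  by move=> i; rewrite -lt0n andbT; case: (0 < i)%N; rewrite ?andbT.
apply: ler_sum => i; rewrite andbT; exact: normc_1Buroot.
Qed.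

Lemma uroot_double (n : nat) : (0 < n)%N -> uroot R n = uroot R (n + n) ^+ 2.
Proof.
move=> n0; rewrite -(@uroot_dvd R n (n + n)) ?addn_gt0 ?n0 ?dvdn_addr //.
by rewrite addnn -mul2n mulnK.
Qed.

Lemma uroot_half_turn (n : nat) : (0 < n)%N -> uroot R (n + n) ^+ n = -1.
Proof.
move=> n0; have p := uroot_prim R (N := n + n); move/(_ _): p.
rewrite addn_gt0 n0 => /(_ isT) p.
have : uroot R (n + n) ^+ n != 1.
  by rewrite -(prim_order_dvd p) gtnNdvd //; lia.
have : (uroot R (n + n) ^+ n) ^+ 2 = 1.
  by rewrite -exprM muln2 -addnn (prim_expr_order p).
by move/eqP; rewrite sqrf_eq1 => /orP[/eqP ->|/eqP //]; rewrite eqxx.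
Qed.

(** Even nodes are n-th roots of unity. At an odd node each geometric sum in the interpolation
    formula has modulus [2 / |1 - w|] with [w] a nontrivial 2n-th root of unity, and the [w] are
    distinct. Hence [n |P| <= B * 2 * (2n * 2H)], with [H] the harmonic sum, which gives the factor
    8. *)
Lemma abs_circ_interpolation P n (B : R) : (0 < n)%N -> (size P <= n)%N ->
  (forall k, abs_circ P (node R n k) <= B) ->
  forall k, abs_circ P (node R (n + n) k) <= 8 * harmonic_sum (n + n) * B.
Proof.
move=> n0 sP leB k.
have N0 : (0 < n + n)%N by rewrite addn_gt0 n0.
have pz := uroot_prim R N0.
have B0 : 0 <= B by apply: le_trans (leB 0%N); exact: abs_circ_ge0.
have H1 : 1 <= harmonic_sum (n + n).
  rewrite /harmonic_sum big_ltn; last by lia.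
  by rewrite invr1 lerDl sumr_ge0 // => i _; rewrite invr_ge0.
have leB' j : normc (cpoly P).[uroot R n ^+ j] <= B.
  by rewrite -expi_node -abs_circE.
rewrite abs_circE expi_node.
have [ko|ke] := boolP (odd k); last first.
  have -> : uroot R (n + n) ^+ k = uroot R n ^+ k./2.
    by rewrite (uroot_double n0) -exprM mul2n even_halfK.
  by apply: le_trans (leB' _) _; rewrite ler_peMl //; lra.
set z := uroot R (n + n) in pz *.
have zn : (z ^+ k) ^+ n = -1.
  by rewrite exprAC uroot_half_turn // -signr_odd ko.
(* The argument of the i-th kernel as a power of [z]. The exponent is odd, hence nonzero, and
   determines [i]. *)
pose h (i : 'I_n) : 'I_(n + n) := Ordinal (ltn_pmod (k + 2 * (n - i)) N0).
have hE (i : 'I_n) : z ^+ k * uroot R n ^+ (n - i) = z ^+ h i.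
  by rewrite (uroot_double n0) -exprM -exprD /= (prim_expr_mod pz).
have h_odd (i : 'I_n) : odd (h i).
  by rewrite /= odd_mod ?addnn ?odd_double // oddD ko oddM.
have h_inj : injective h.
  have modE (i : 'I_n) : ((n - i) %% n = if i == 0 :> nat then 0 else n - i)%N.
    by case: posnP => [->|i0]; rewrite ?subn0 ?modnn // modn_small //; lia.
  move=> i j /(congr1 val) /= /eqP; rewrite eqn_modDl addnn -mul2n -!muln_modr.
  rewrite eqn_pmul2l // !modE => /eqP e; apply: val_inj => /=; move: e.
  by have := ltn_ord i; have := ltn_ord j; case: eqP; case: eqP; lia.
have w1 (i : 'I_n) : normc (\sum_(j < n) (z ^+ k * uroot R n ^+ (n - i)) ^+ j)
    = 2 * (normc (1 - z ^+ h i))^-1.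
  rewrite -hE; set w := _ * _.
  have wn : w ^+ n = -1.
    by rewrite exprMn zn exprAC (prim_expr_order (uroot_prim R n0)) expr1n mulr1.
  have := subrX1 w n; rewrite wn => /(congr1 (@normc R)).
  rewrite normcM -opprD normcN -(natrD _ 1 1) normc_nat => e2.
  have w0 : normc (1 - w) != 0.
    apply/eqP => /eq0_normc /eqP; rewrite subr_eq0 => /eqP we.
    move: wn; rewrite -we expr1n => /eqP; rewrite -subr_eq0 opprK -(natrD _ 1 1).
    by rewrite pnatr_eq0.
  rewrite -normcN opprB in e2.
  by apply: (mulfI w0); rewrite -e2 mulrC divfK.
have := horner_interpolation (z ^+ k) n0 sP.
move=> /(congr1 (@normc R)); rewrite normcM normc_nat => E.
rewrite -(ler_pM2l (x := n%:R)) ?ltr0n // E.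
apply: le_trans (normc_sum_le _ _ _) _.
apply: (@le_trans _ _ (\sum_(i < n) B * (2 * (normc (1 - z ^+ h i))^-1))).
  apply: ler_sum => i _; rewrite normcM w1 ler_wpM2r //.
  by rewrite mulr_ge0 // invr_ge0 normc_ge0.
rewrite -!mulr_sumr.
have -> : \sum_(i < n) (normc (1 - z ^+ h i))^-1 =
          \sum_(l in h @: 'I_n) (normc (1 - z ^+ l))^-1.
  rewrite big_imset /=; last by move=> ? ? _ _; exact: h_inj.
  by apply: eq_bigl => i.
have : \sum_(l in h @: 'I_n) (normc (1 - z ^+ l))^-1 <=
   \sum_(l < n + n | l != 0%N :> nat) (normc (1 - z ^+ l))^-1.
  rewrite big_mkcond [leRHS]big_mkcond; apply: ler_sum => l _.
  case: imsetP => [[i _ ->]|_].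
    by rewrite ifT //; apply: contraTneq (h_odd i) => ->.
  by case: ifP => // _; rewrite invr_ge0 normc_ge0.
move=> /le_trans /(_ (sum_normc_1Buroot N0)).
set S := \sum_(l in _) _; rewrite natrD -[_ *+ 2]mulr_natr => HS.
have -> : n%:R * (8 * harmonic_sum (n + n) * B)
   = B * (2 * ((n%:R + n%:R) * (harmonic_sum (n + n) * 2))) by ring.
by rewrite !ler_wpM2l.
Qed.

End Interpolation.

(** * Rotations and Gauss sums *)

Section Rotation.
Variable R : realType.
Implicit Types (A B : {poly R}) (n : nat) (r : R).

Lemma size_rotp n r A : (0 < n)%N -> (size (rotp n r A) <= n)%N.
Proof.
move=> n0; rewrite -ltnS -(size_XnsubC (1 : R) n0); apply: ltn_modpN0.
by rewrite -size_poly_eq0 size_XnsubC.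
Qed.

Lemma rotpD n r A B : rotp n r (A + B) = rotp n r A + rotp n r B.
Proof. by rewrite /rotp mulrDr modpD. Qed.

(** At an n-th root of unity the modulus ['X^n - 1] of the reduction vanishes and the monomial
    factor has absolute value 1. *)
Lemma abs_circ_rotp n r A k : (0 < n)%N ->
  abs_circ (rotp n r A) (node R n k) = abs_circ A (node R n k).
Proof.
move=> n0; rewrite !abs_circE expi_node /rotp; set t := `|_|%N.
set z := uroot R n ^+ k.
have zn : z ^+ n = 1 by rewrite exprAC (prim_expr_order (uroot_prim R n0)) expr1n.
have := divp_eq ('X^t * A) ('X^n - 1); move/(congr1 (fun P => normc (cpoly P).[z])).
rewrite /cpoly rmorphD !rmorphM rmorphB /= !map_polyXn rmorph1.
rewrite hornerD !hornerM hornerD hornerN hornerC !hornerXn zn subrr mulr0 add0r.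
by rewrite normcM normcX normc_uroot expr1n mul1r => ->.
Qed.

(** By Parseval both sides depend only on absolute values at the n-th roots of unity, so the
    permutation of coefficients need not be made explicit. *)
Lemma sum_sqr_coef_rotp n r A : (0 < n)%N -> (size A <= n)%N ->
  \sum_(j < n) (rotp n r A)`_j ^+ 2 = \sum_(j < n) A`_j ^+ 2.
Proof.
move=> n0 sA; apply: (mulfI (x := n%:R)); first by rewrite pnatr_eq0 -lt0n.
rewrite -!parseval ?size_rotp //.
by apply: eq_bigr => k _; rewrite abs_circ_rotp.
Qed.

End Rotation.

(** * Coefficients of J and V, and Gauss sums of the Jacobi character *)

Section GaussSums.
Variables (R : realType) (n : nat).
Hypotheses (n_gt1 : (1 < n)%N) (n_odd : odd n) (n_sf : squarefree n).

Let n_gt0 : (0 < n)%N. Proof. exact: ltnW. Qed.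

Lemma charJE : charJ R n = \poly_(j < n) (jacobi j n)%:~R.
Proof.
rewrite poly_def -(big_mkord xpredT (fun j => (jacobi j n)%:~R *: 'X^j)) big_ltn //.
(* The index [0] can be added to the range because [gcd(0, n) = n > 1]. *)
rewrite jacobi_eq0 ?scale0r ?add0r //.
by rewrite /coprime gcd0n gtn_eqF.
Qed.

Lemma polyVE : polyV R n = \poly_(j < n) (~~ coprime j n)%:R.
Proof.
rewrite poly_def -(big_mkord xpredT (fun j => (~~ coprime j n)%:R *: 'X^j)).
rewrite /polyV big_mkcond; apply: eq_bigr => j _.
have g0 : (0 < gcdn j n)%N by rewrite gcdn_gt0 n_gt0 orbT.
by rewrite ltn_neqAle g0 andbT eq_sym -/(coprime j n); case: coprime; rewrite ?scale0r ?scale1r.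
Qed.

Lemma size_charJ : (size (charJ R n) <= n)%N.
Proof. by rewrite charJE size_poly. Qed.

Lemma size_polyV : (size (polyV R n) <= n)%N.
Proof. by rewrite polyVE size_poly. Qed.

Lemma sum_sqr_charJ : \sum_(j < n) (charJ R n)`_j ^+ 2 = (totient n)%:R.
Proof.
rewrite totient_count_coprime natr_sum big_mkord; apply: eq_bigr => j _.
rewrite charJE coef_poly ltn_ord -rmorphXn /= jacobi_sqr // coprime_sym.
by case: coprime.
Qed.

Lemma sum_sqr_polyV : \sum_(j < n) (polyV R n)`_j ^+ 2 = n%:R - (totient n)%:R.
Proof.
rewrite totient_count_coprime natr_sum big_mkord.
have -> : n%:R = \sum_(j < n) (1 : R) by rewrite sumr_const card_ord.
rewrite -sumrB; apply: eq_bigr => j _; rewrite polyVE coef_poly ltn_ord coprime_sym.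
by case: coprime; rewrite ?subrr ?subr0 ?expr0n ?expr1n.
Qed.

(** V fills in exactly the zero coefficients of J, so every coefficient of the sum is [1] or
    [-1]. *)
Lemma sum_sqr_charJDpolyV : \sum_(j < n) (charJ R n + polyV R n)`_j ^+ 2 = n%:R.
Proof.
rewrite -[n in RHS]card_ord -sumr_const; apply: eq_bigr => j _.
rewrite coefD charJE polyVE !coef_poly ltn_ord.
have := jacobi_sqr j n_gt0; have [c|nc] := boolP (coprime j n).
  by rewrite addr0 -rmorphXn /= => ->.
by rewrite jacobi_eq0 // add0r expr1n.
Qed.

Let G k := (cpoly (charJ R n)).[uroot R n ^+ k].

Lemma gaussE k : G k = \sum_(j < n) (jacobi j n)%:~R * uroot R n ^+ (k * j).
Proof.
rewrite /G (horner_cpoly _ size_charJ); apply: eq_bigr => j _.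
by rewrite charJE coef_poly ltn_ord exprM rmorph_int.
Qed.

(** Substitute [j -> u j mod n], a permutation of the residues, and use multiplicativity. *)
Lemma gauss_scale k u : coprime u n -> G k = (jacobi u n)%:~R * G (k * u).
Proof.
move=> cu; rewrite !gaussE mulr_sumr.
pose h (j : 'I_n) : 'I_n := Ordinal (ltn_pmod (u * j) n_gt0).
have h_inj : injective h.
  move=> i j; wlog le_ji : i j / (j <= i)%N.
    by move=> H; case: (leqP j i) => [/H //|/ltnW /H {}H /esym /H].
  move=> /(congr1 val) /= /eqP; rewrite eqn_mod_dvd ?leq_mul2l ?le_ji ?orbT //.
  rewrite -mulnBr Gauss_dvdr 1?coprime_sym // => d; apply: val_inj => /=.
  have := ltn_ord i; case: (posnP (i - j)) => [|ij0]; first by lia.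
  by have := dvdn_leq ij0 d; lia.
rewrite (reindex_inj h_inj); apply: eq_bigr => j _ /=.
rewrite jacobi_modn jacobiM rmorphM /= -mulrA; congr (_ * (_ * _)).
apply/eqP; rewrite (eq_prim_root_expr (uroot_prim R n_gt0)).
by rewrite modnMmr mulnA.
Qed.

(** Choose [u] with symbol [-1] and [u = 1] modulo [n / q]. As [q] divides the index, multiplying it
    by [u] changes nothing modulo [n], so the Gauss sum equals its own negative. *)
Lemma gauss_eq0 k q : q \in primes n -> (q %| k)%N -> G k = 0.
Proof.
move=> qn /dvdnP[k' ->]; have [u [ju cu um]] := exists_jacobiN1 n_odd n_sf qn.
have q_dvd : (q %| n)%N by move: qn; rewrite mem_primes => /and3P[].
have := gauss_scale (k' * q) cu.
have -> : G (k' * q * u) = G (k' * q).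
  rewrite /G; congr (_.[_]).
  apply/eqP; rewrite (eq_prim_root_expr (uroot_prim R n_gt0)) -mulnA.
  rewrite -[X in _ == X]modnMmr -modnMmr.
  have -> : ((q * u) %% n = q %% n)%N; last by [].
  have -> : n = (q * (n %/ q))%N by rewrite mulnC divnK.
  by rewrite -muln_modr um muln_modr muln1.
rewrite ju rmorphN1 mulN1r => /eqP; rewrite -addr_eq0 -mulr2n -mulr_natr mulf_eq0 pnatr_eq0 orbF.
by move/eqP.
Qed.

Lemma normc_gauss k : coprime k n -> normc (G k) = normc (G 1).
Proof.
move=> ck; rewrite (gauss_scale 1 ck) mul1n normcM.
have : normc ((jacobi k n)%:~R : R[i]) ^+ 2 = 1.
  by rewrite -normcX -rmorphXn /= jacobi_sqr // ck normc1.
move/eqP; rewrite sqrf_eq1 => /orP[/eqP ->|/eqP j1]; first by rewrite mul1r.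
by have := normc_ge0 ((jacobi k n)%:~R : R[i]); rewrite j1; lra.
Qed.

(** By Parseval the squares of all [n] Gauss sums add up to [n * phi(n)], and the [phi(n)] sums at
    coprime indices share one modulus. *)
Lemma normc_gauss1 : normc (G 1) ^+ 2 <= n%:R.
Proof.
have phi0 : (0 : R) < (totient n)%:R by rewrite ltr0n totient_gt0.
have := parseval size_charJ; rewrite sum_sqr_charJ => E.
rewrite -(ler_pM2r phi0) -E.
rewrite totient_count_coprime natr_sum mulr_sumr big_mkord; apply: ler_sum => k _.
rewrite abs_circE expi_node -/(G k) coprime_sym.
by have [/normc_gauss ->|_] := boolP (coprime k n); rewrite ?mulr1 // mulr0 sqr_ge0.
Qed.

Lemma abs_circ_charJ k : abs_circ (charJ R n) (node R n k) <= Num.sqrt n%:R.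
Proof.
rewrite abs_circE expi_node -/(G k).
have [ck|] := boolP (coprime k n).
  by rewrite (normc_gauss ck) -[normc _]ger0_norm ?normc_ge0 // -sqrtr_sqr ler_wsqrtr // normc_gauss1.
rewrite /coprime => nc.
have g0 : (0 < gcdn k n)%N by rewrite gcdn_gt0 n_gt0 orbT.
have /pdivP[q pq] : (1 < gcdn k n)%N by rewrite ltn_neqAle eq_sym nc.
rewrite dvdn_gcd => /andP[qk qn].
by rewrite (gauss_eq0 (q := q)) ?normc0 ?sqrtr_ge0 // mem_primes pq n_gt0.
Qed.

Lemma abs_circ_charJ_eq0 k q : q \in primes n -> (q %| k)%N ->
  abs_circ (charJ R n) (node R n k) = 0.
Proof.
by move=> qn qk; rewrite abs_circE expi_node -/(G k) (gauss_eq0 qn qk) normc0.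
Qed.

End GaussSums.

(** * The main inequality *)

Lemma sum_dvdn (p n : nat) : (0 < n)%N -> (p %| n)%N ->
  (\sum_(j < n) (p %| j) = n %/ p)%N.
Proof.
move=> n0 pn; rewrite divn_count_dvd -(big_mkord xpredT (fun j => (p %| j) : nat)).
by rewrite big_ltn // dvdn0 [RHS]big_nat_recr //= pn addnC.
Qed.

Lemma totient_leq (n : nat) : (totient n <= n)%N.
Proof.
rewrite totient_count_coprime big_mkord -[X in (_ <= X)%N]card_ord -sum1_card.
by apply: leq_sum => i _; case: coprime.
Qed.

(** Union bound: a residue not coprime to [n] is a multiple of some prime [q] of [n], and there are
    [n / q <= n / pdiv n] of these. *)
Lemma leq_totient_primes (n : nat) : (1 < n)%N ->
  (n <= totient n + size (primes n) * (n %/ pdiv n))%N.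
Proof.
move=> n1; have n0 := ltnW n1.
rewrite -[X in (X <= _)%N]card_ord -sum1_card totient_count_coprime big_mkord.
apply: (@leq_trans (\sum_(j < n) coprime n j + \sum_(q <- primes n) \sum_(j < n) (q %| j))).
  rewrite exchange_big -big_split /=; apply: leq_sum => j _.
  have [//|nc] := boolP (coprime n j); rewrite add0n.
  have g0 : (0 < gcdn n j)%N by rewrite gcdn_gt0 n0.
  have /pdivP[q pq] : (1 < gcdn n j)%N by rewrite ltn_neqAle eq_sym -/(coprime n j) nc.
  rewrite dvdn_gcd => /andP[qn qj].
  have qin : q \in primes n by rewrite mem_primes pq n0.
  by rewrite (big_rem q qin) /= qj.
rewrite leq_add2l -sum1_size big_distrl /= !big_seq; apply: leq_sum => q.
rewrite mem_primes => /and3P[pq _ qn]; rewrite sum_dvdn // mul1n.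
by apply: leq_div2l; rewrite ?pdiv_gt0 // pdiv_min_dvd // prime_gt1.
Qed.

Lemma leq_exp2_primes (n : nat) : (0 < n)%N -> (2 ^ size (primes n) <= n)%N.
Proof.
move=> n0; rewrite [X in (_ <= X)%N](prod_prime_decomp n0) prime_decompE big_map /=.
rewrite -sum1_size expn_sum !big_seq.
apply: leq_prod => q; rewrite mem_primes => qin; move: (qin) => /and3P[pq _ _].
rewrite expn1 (leq_trans (prime_gt1 pq)) // -[X in (X <= _)%N]expn1.
by rewrite leq_exp2l ?prime_gt1 // logn_gt0 mem_primes.
Qed.

(** The tangent to [x ^+ 4] at [c]; summed with [c] the mean, it yields the power mean
    inequality. *)
Lemma quartic_tangent (R : realType) (x c : R) : 0 <= c -> 0 <= x ->
  4 * c ^+ 3 * x - 3 * c ^+ 4 <= x ^+ 4.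
Proof.
move=> c0 x0; rewrite -subr_ge0.
have -> : x ^+ 4 - (4 * c ^+ 3 * x - 3 * c ^+ 4)
  = (x - c) ^+ 2 * (x ^+ 2 + 2 * (c * x) + 3 * c ^+ 2) by ring.
by rewrite mulr_ge0 ?sqr_ge0 // !addr_ge0 ?mulr_ge0 ?sqr_ge0.
Qed.

(** Applied with [a], [b], [c] the absolute values of J, V and J + V. The part of [(a - b) ^+ 4]
    left out is [b^2 ((b - 2a)^2 + 2a^2)]. *)
Lemma quartic_perturb (R : realType) (a b c : R) : 0 <= c -> `|a - b| <= c ->
  a ^+ 4 - 4 * (a ^+ 3 * b) <= c ^+ 4.
Proof.
move=> c0 abc; have : (a - b) ^+ 4 <= c ^+ 4.
  have -> : (a - b) ^+ 4 = `|a - b| ^+ 4.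
    by rewrite -[4%N]/(2 * 2)%N !exprM real_normK ?num_real.
  by rewrite lerXn2r ?nnegrE.
apply: le_trans; rewrite -subr_ge0.
have -> : (a - b) ^+ 4 - (a ^+ 4 - 4 * (a ^+ 3 * b)) = b ^+ 2 * ((b - 2 * a) ^+ 2 + 2 * a ^+ 2) by ring.
by apply: mulr_ge0; rewrite ?sqr_ge0 //; apply: addr_ge0; rewrite ?sqr_ge0 // mulr_ge0 ?sqr_ge0.
Qed.

(** * Lower bounds for the fourth moment of J + V at the 2n-th roots of unity *)

Section MainInequality.
Variables (R : realType) (n : nat) (r : R).
Hypotheses (n_gt1 : (1 < n)%N) (n_odd : odd n) (n_sf : squarefree n).
Let n_gt0 : (0 < n)%N. Proof. exact: ltnW. Qed.

Let p := pdiv n.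
Let J := rotp n r (charJ R n).
Let V := rotp n r (polyV R n).
Let x k : R := node R (n + n) k.
Let H : R := harmonic_sum R (n + n).

Let p_pr : prime p. Proof. exact: pdiv_prime. Qed.
Let p_dvd : (p %| n)%N. Proof. exact: pdiv_dvd. Qed.

(** Summing over the p-th roots of unity keeps [p] times the coefficients at the [n / p] multiples
    of [p], all equal to 1 since [p] divides [n]. *)
Lemma sum_abs_polyV_ge :
  n%:R <= \sum_(m < p) abs_circ (polyV R n) (node R n (m * (n %/ p))).
Proof.
have -> : n%:R = normc (\sum_(m < p) (cpoly (polyV R n)).[uroot R p ^+ m]).
  under eq_bigr do rewrite (horner_cpoly _ (size_polyV R n_gt1)).
  rewrite exchange_big /=.
  have -> : \sum_(j < n) \sum_(m < p) ((polyV R n)`_j)%:C%C * (uroot R p ^+ m) ^+ j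
     = \sum_(j < n) (p * (p %| j))%:R.
    apply: eq_bigr => j _; rewrite -mulr_sumr.
    under eq_bigr do rewrite exprAC.
    rewrite (sum_prim_root _ (uroot_prim R (prime_gt0 p_pr))) polyVE // coef_poly ltn_ord.
    case: ifP => pj; last by rewrite mulr0 muln0.
    have -> : coprime j n = false; last by rewrite muln1 mul1r.
    apply/negbTE/negP => /eqP g1; have : (p %| gcdn j n)%N by rewrite dvdn_gcd pj.
    by rewrite g1 dvdn1 => /eqP p1; move: p_pr; rewrite p1.
  by rewrite -natr_sum -big_distrr /= sum_dvdn // normc_nat mulnC divnK.
apply: le_trans (normc_sum_le _ _ _) _; apply: ler_sum => m _.
by rewrite abs_circE expi_node mulnC exprM uroot_dvd.
Qed.

Lemma sum_abs4_polyV_ge : n%:R ^+ 4 / p%:R ^+ 3 <=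
  \sum_(m < p) abs_circ (polyV R n) (node R n (m * (n %/ p))) ^+ 4.
Proof.
have p0 : (0 : R) < p%:R by rewrite ltr0n prime_gt0.
(* The tangent point is the lower bound [n / p] for the mean of the [p] values. *)
pose c : R := n%:R / p%:R; have c0 : 0 <= c by rewrite divr_ge0.
apply: (@le_trans _ _ (\sum_(m < p)
   (4 * c ^+ 3 * abs_circ (polyV R n) (node R n (m * (n %/ p))) - 3 * c ^+ 4))); last first.
  by apply: ler_sum => m _; apply: quartic_tangent => //; exact: abs_circ_ge0.
rewrite sumrB -mulr_sumr sumr_const card_ord -[3 * c ^+ 4 *+ p]mulr_natr.
have := sum_abs_polyV_ge; set s := \sum_(m < p) _ => hs.
have h : 4 * c ^+ 3 * n%:R <= 4 * c ^+ 3 * s.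
  by rewrite ler_wpM2l // mulr_ge0 // exprn_ge0.
have nE : n%:R = c * p%:R by rewrite /c divfK // gt_eqF.
have -> : n%:R ^+ 4 / p%:R ^+ 3 = c ^+ 4 * p%:R.
  by rewrite nE; field; rewrite gt_eqF.
have h2 : 4 * c ^+ 3 * n%:R = 4 * (c ^+ 4 * p%:R) by rewrite nE; ring.
by rewrite h2 in h; lra.
Qed.

Let size_J : (size J <= n)%N. Proof. exact: size_rotp. Qed.
Let size_V : (size V <= n)%N. Proof. exact: size_rotp. Qed.

Let a k := abs_circ J (x k).
Let b k := abs_circ V (x k).
Let c k := abs_circ (J + V) (x k).

(** Position of the m-th p-th root of unity among the 2n-th roots. *)
Let h (m : nat) := (m * (n %/ p) * 2)%N.

Let expi_double k : expi (x (k * 2)) = expi (node R n k).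
Proof. by rewrite !expi_node mulnC exprM -uroot_double. Qed.

Let bh m : b (h m) = abs_circ (polyV R n) (node R n (m * (n %/ p))).
Proof. by rewrite /b abs_circE expi_double -abs_circE abs_circ_rotp. Qed.

(** For composite [n], a prime factor of [n / p] divides both [n] and the index [m * (n / p)], so
    the Gauss sum there vanishes. *)
Let ah m : ~~ prime n -> a (h m) = 0.
Proof.
move=> npr; rewrite /a abs_circE expi_double -abs_circE abs_circ_rotp //.
have m1 : (1 < n %/ p)%N.
  rewrite ltn_divRL // mul1n ltn_neqAle pdiv_leq // andbT.
  by apply: contraNneq npr => <-.
apply: (@abs_circ_charJ_eq0 _ _ n_gt1 n_odd n_sf _ (pdiv (n %/ p))).
  rewrite mem_primes pdiv_prime // n_gt0 /=.
  by rewrite (dvdn_trans (pdiv_dvd _)) // dvdn_div.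
by rewrite (dvdn_trans (pdiv_dvd _)) // dvdn_mull.
Qed.

Let h_lt (m : 'I_p) : (h m < n + n)%N.
Proof.
rewrite /h addnn -muln2 ltn_pmul2r // -[X in (_ < X)%N](divnK p_dvd) mulnC ltn_pmul2l //.
by rewrite divn_gt0 ?prime_gt0 // dvdn_leq.
Qed.

Let h_inj : injective (fun m : 'I_p => Ordinal (h_lt m)).
Proof.
move=> i j /(congr1 val) /eqP /=; rewrite /h eqn_pmul2r // eqn_pmul2r => [/eqP e|].
  exact: val_inj.
by rewrite divn_gt0 ?prime_gt0 // dvdn_leq.
Qed.

Let T : {set 'I_(n + n)} := [set Ordinal (h_lt m) | m in 'I_p].

Let a_ge0 k : 0 <= a k. Proof. exact: abs_circ_ge0. Qed.
Let b_ge0 k : 0 <= b k. Proof. exact: abs_circ_ge0. Qed.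
Let c_ge0 k : 0 <= c k. Proof. exact: abs_circ_ge0. Qed.

Let abc k : `|a k - b k| <= c k.
Proof.
rewrite /a /b /c !abs_circE /cpoly rmorphD hornerD -!/(cpoly _).
move: (cpoly J).[_] (cpoly V).[_] => z w.
have := normcD_le (z + w) (- w); have := normcD_le (z + w) (- z).
rewrite addrK [z + w]addrC addrK !normcN [w + z]addrC.
by rewrite ler_norml; lra.
Qed.

Let sumT : \sum_(k in T) b k ^+ 4 >= n%:R ^+ 4 / p%:R ^+ 3.
Proof.
rewrite big_imset /=; last by move=> ? ? _ _; exact: h_inj.
rewrite [X in _ <= X](eq_bigl xpredT) //.
by under eq_bigr do rewrite bh; exact: sum_abs4_polyV_ge.
Qed.

Lemma sum_abs4_ge_peaks : ~~ prime n ->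
  n%:R ^+ 4 / p%:R ^+ 3 <= \sum_(k < n + n) c k ^+ 4.
Proof.
move=> npr; apply: (le_trans sumT).
rewrite big_mkcond; apply: ler_sum => k _; case: ifP => kT; last by rewrite exprn_ge0.
case/imsetP: kT => m _ ->; rewrite lerXn2r ?nnegrE //.
by have := abc (h m); rewrite ah // sub0r normrN ger0_norm.
Qed.

(** On [T] the terms containing J vanish, so the full fourth power of V is gained there; elsewhere
    the pointwise perturbation bound applies. *)
Lemma sum_abs4_ge_split : ~~ prime n ->
  \sum_(k < n + n) a k ^+ 4 - 4 * \sum_(k < n + n) a k ^+ 3 * b k + n%:R ^+ 4 / p%:R ^+ 3
    <= \sum_(k < n + n) c k ^+ 4.
Proof.
move=> npr; rewrite -lerBrDl; apply: (le_trans sumT).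
rewrite mulr_sumr -sumrB -sumrB big_mkcond; apply: ler_sum => k _.
case: ifP => kT; last by rewrite subr_ge0 quartic_perturb.
case/imsetP: kT => m _ -> /=; rewrite ah // !expr0n /= mul0r mulr0 !subr0 lerXn2r ?nnegrE //.
by have := abc (h m); rewrite ah // sub0r normrN ger0_norm.
Qed.

Lemma sum_abs4_ge_perturb :
  \sum_(k < n + n) a k ^+ 4 - 4 * \sum_(k < n + n) a k ^+ 3 * b k
    <= \sum_(k < n + n) c k ^+ 4.
Proof. by rewrite mulr_sumr -sumrB; apply: ler_sum => k _; apply: quartic_perturb. Qed.

Let a_le k : a k <= 8 * H * Num.sqrt n%:R.
Proof.
apply: abs_circ_interpolation => // j; rewrite abs_circ_rotp //.
exact: abs_circ_charJ.
Qed.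

(** Quadrature with [n] nodes and with [N] nodes computes the same integral. *)
Lemma parseval_wide (P : {poly R}) N : (size P <= n)%N -> (n <= N)%N ->
  \sum_(k < N) abs_circ P (node R N k) ^+ 2 = N%:R * \sum_(j < n) P`_j ^+ 2.
Proof.
move=> sP nN.
have [_ e1] := quad_exact_sqr_abs sP (leqnn n); have [_] := quad_exact_sqr_abs sP nN.
rewrite {}e1 (parseval sP) mulKf ?pnatr_eq0 -?lt0n // => ->.
by rewrite mulVKf // pnatr_eq0 -lt0n (leq_trans n_gt0).
Qed.

(** Bound one factor [a k ^+ 2] by its supremum [64 H^2 n], split the remaining [a k * b k] by AM-GM
    with weight [l], and apply Parseval; [128 = 4 * 64 / 2]. *)
Lemma sum_cross_le (l : R) : 0 < l ->
  4 * \sum_(k < n + n) a k ^+ 3 * b k <=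
  (n + n)%:R * (128 * H ^+ 2 * n%:R * (l * n%:R + (n%:R - (totient n)%:R) / l)).
Proof.
move=> l0.
have nn0 : (0 : R) <= n%:R by [].
have a2 : \sum_(k < n + n) a k ^+ 2 <= (n + n)%:R * n%:R.
  rewrite parseval_wide ?leq_addr // sum_sqr_coef_rotp ?size_charJ // sum_sqr_charJ //.
  by rewrite ler_wpM2l // ler_nat totient_leq.
have b2 : \sum_(k < n + n) b k ^+ 2 = (n + n)%:R * (n%:R - (totient n)%:R).
  by rewrite parseval_wide ?leq_addr // sum_sqr_coef_rotp ?size_polyV // sum_sqr_polyV.
have B2 k : a k ^+ 2 <= 64 * H ^+ 2 * n%:R.
  have : a k ^+ 2 <= (8 * H * Num.sqrt n%:R) ^+ 2.
    by rewrite lerXn2r ?nnegrE // (le_trans (a_ge0 k)) ?a_le.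
  have -> : (8 * H * Num.sqrt n%:R) ^+ 2 = 64 * H ^+ 2 * Num.sqrt n%:R ^+ 2 by ring.
  by rewrite sqr_sqrtr.
have step (k : 'I_(n + n)) : a k ^+ 3 * b k <=
    64 * H ^+ 2 * n%:R * (l / 2 * a k ^+ 2 + (2 * l)^-1 * b k ^+ 2).
  rewrite exprSr -mulrA; apply: ler_pM => //; rewrite ?mulr_ge0 ?sqr_ge0 //.
  rewrite -subr_ge0.
  have -> : l / 2 * a k ^+ 2 + (2 * l)^-1 * b k ^+ 2 - a k * b k =
     (2 * l)^-1 * (l * a k - b k) ^+ 2 by field; rewrite gt_eqF.
  by rewrite mulr_ge0 ?sqr_ge0 // invr_ge0 mulr_ge0 // ltW.
apply: (@le_trans _ _ (4 * \sum_(k < n + n)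
  (64 * H ^+ 2 * n%:R * (l / 2 * a k ^+ 2 + (2 * l)^-1 * b k ^+ 2)))).
  by rewrite ler_wpM2l // ler_sum // => k _; exact: step.
rewrite -mulr_sumr big_split /= -!mulr_sumr b2.
have -> : (n + n)%:R * (128 * H ^+ 2 * n%:R * (l * n%:R + (n%:R - (totient n)%:R) / l))
  = 4 * (64 * H ^+ 2 * n%:R * (l / 2 * ((n + n)%:R * n%:R)
        + (2 * l)^-1 * ((n + n)%:R * (n%:R - (totient n)%:R)))).
  by field; rewrite gt_eqF.
apply: ler_wpM2l => //; apply: ler_wpM2l; first by rewrite mulr_ge0 // mulr_ge0 // sqr_ge0.
by rewrite lerD2r; apply: ler_wpM2l => //; rewrite divr_ge0 // ltW.
Qed.

Let mJ := (n + n)%:R^-1 * \sum_(k < n + n) a k ^+ 4.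
Let mJV := (n + n)%:R^-1 * \sum_(k < n + n) c k ^+ 4.

Lemma invr_merit_charJ : (merit J)^-1 = mJ / (totient n)%:R ^+ 2 - 1.
Proof.
apply: invr_merit => //; last by rewrite ltr0n totient_gt0.
by rewrite sum_sqr_coef_rotp ?size_charJ // sum_sqr_charJ.
Qed.

Lemma invr_merit_sum : (merit (J + V))^-1 = mJV / n%:R ^+ 2 - 1.
Proof.
apply: invr_merit => //; last by rewrite ltr0n.
  by rewrite (leq_trans (size_polyD _ _)) // geq_max size_J.
rewrite -rotpD sum_sqr_coef_rotp ?sum_sqr_charJDpolyV //.
by rewrite (leq_trans (size_polyD _ _)) // geq_max size_charJ ?size_polyV.
Qed.

Lemma invr_merit_ge_peaks : ~~ prime n ->
  n%:R / (2 * p%:R ^+ 3) - 1 <= (merit (J + V))^-1.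
Proof.
move=> npr; rewrite invr_merit_sum lerD2r.
have n0 : (n%:R : R) != 0 by rewrite pnatr_eq0 -lt0n.
have p0 : (p%:R : R) != 0 by rewrite pnatr_eq0 -lt0n prime_gt0.
have -> : n%:R / (2 * p%:R ^+ 3) = (n + n)%:R^-1 * (n%:R ^+ 4 / p%:R ^+ 3) / n%:R ^+ 2 :> R.
  have -> : (n + n)%:R = 2 * n%:R :> R by rewrite natrD; ring.
  by field; rewrite n0 p0.
rewrite ler_wpM2r ?invr_ge0 ?sqr_ge0 // ler_wpM2l ?invr_ge0 //.
exact: sum_abs4_ge_peaks.
Qed.

(* For prime n there are no peaks, but then n / (2 p^3) = 1 / (2 n^2). *)
Lemma invr_merit_ge_perturb (l : R) : 0 < l ->
  ((merit J)^-1 + 1) * ((totient n)%:R / n%:R) ^+ 2 + n%:R / (2 * p%:R ^+ 3) - n%:R^-1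
   - 128 * H ^+ 2 * (l + (1 - (totient n)%:R / n%:R) / l)
   <= (merit (J + V))^-1 + 1.
Proof.
move=> l0.
suff main (u v : R) : u = mJ / (totient n)%:R ^+ 2 - 1 -> v = mJV / n%:R ^+ 2 - 1 ->
    (u + 1) * ((totient n)%:R / n%:R) ^+ 2 + n%:R / (2 * p%:R ^+ 3) - n%:R^-1
     - 128 * H ^+ 2 * (l + (1 - (totient n)%:R / n%:R) / l) <= v + 1.
  exact: main invr_merit_charJ invr_merit_sum.
move=> -> ->; rewrite !subrK.
have n0 : (n%:R : R) != 0 by rewrite pnatr_eq0 -lt0n.
have n0' : (0 : R) < n%:R by rewrite ltr0n.
have p0 : (p%:R : R) != 0 by rewrite pnatr_eq0 -lt0n prime_gt0.
have t0 : ((totient n)%:R : R) != 0 by rewrite pnatr_eq0 -lt0n totient_gt0.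
have cross := sum_cross_le l0.
pose E := 128 * H ^+ 2 * n%:R * (l * n%:R + (n%:R - (totient n)%:R) / l).
have key : mJ - E + (if prime n then 0 else n%:R ^+ 3 / (2 * p%:R ^+ 3)) <= mJV.
  have nn0 : (0 : R) < (n + n)%:R by rewrite ltr0n addn_gt0 n_gt0.
  have nn0' : ((n + n)%:R : R) != 0 by rewrite gt_eqF.
  rewrite -(ler_pM2l nn0) /mJV mulVKf // !mulrDr mulVKf // mulrN.
  case: ifPn => npr.
    rewrite mulr0 addr0; apply: le_trans sum_abs4_ge_perturb.
    by rewrite lerD2l lerN2.
  apply: le_trans (sum_abs4_ge_split npr).
  have -> : (n + n)%:R * (n%:R ^+ 3 / (2 * p%:R ^+ 3)) = n%:R ^+ 4 / p%:R ^+ 3 :> R.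
    by rewrite natrD; field; rewrite p0.
  by rewrite lerD2r lerD2l lerN2.
set K := if _ then _ else _ in key.
have : mJ / n%:R ^+ 2 - E / n%:R ^+ 2 + K / n%:R ^+ 2 <= mJV / n%:R ^+ 2.
  by rewrite -mulrBl -mulrDl ler_wpM2r // invr_ge0 sqr_ge0.
apply: le_trans.
have -> : mJ / (totient n)%:R ^+ 2 * ((totient n)%:R / n%:R) ^+ 2 = mJ / n%:R ^+ 2.
  by field; rewrite n0 t0.
have -> : E / n%:R ^+ 2 = 128 * H ^+ 2 * (l + (1 - (totient n)%:R / n%:R) / l).
  by rewrite /E; field; rewrite n0 gt_eqF.
set X := _ / _; set Y := 128 * _ * _.
have -> : X + n%:R / (2 * p%:R ^+ 3) - n%:R^-1 - Y = X - Y + (n%:R / (2 * p%:R ^+ 3) - n%:R^-1) by ring.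
(* The subtracted [n%:R^-1] compensates for the missing peaks when [n] is prime and [p = n]; for
   composite [n] it is slack. *)
rewrite lerD2l /K; case: ifPn => npr.
  have -> : p = n by exact: pdiv_id.
  rewrite mul0r subr_le0.
  have -> : n%:R / (2 * n%:R ^+ 3) = n%:R^-1 * (2 * n%:R)^-1 :> R by field; rewrite n0.
  rewrite ler_piMr ?invr_ge0 // invf_le1 ?mulr_gt0 // -natrM ler1n muln_gt0.
  by rewrite n_gt0.
have -> : n%:R ^+ 3 / (2 * p%:R ^+ 3) / n%:R ^+ 2 = n%:R / (2 * p%:R ^+ 3) :> R.
  by field; rewrite n0 p0.
by rewrite gerBl invr_ge0.
Qed.

End MainInequality.

(** * Passage to the limit *)

(** With [q = L / (k + 1)] rounded down, [2^L >= (2^q)^(k+1) >= (q+1)^(k+1)]. One factor [q + 1]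
    absorbs the constants and the other [k] dominate [(L + 2)^k]. *)
Lemma poly_lt_exp2 (C k : nat) :
  exists L0, forall L, (L0 <= L)%N -> (C * (L + 2) ^ k <= 2 ^ L)%N.
Proof.
exists (k.+1 * (C * (k + 3) ^ k))%N => L leL.
set q := (L %/ k.+1)%N.
have Lq : (L + 2 <= q.+1 * (k + 3))%N.
  by have := divn_eq L k.+1; have := ltn_pmod L (ltn0Sn k); rewrite -/q; nia.
have Cq : (C * (k + 3) ^ k <= q.+1)%N.
  by rewrite ltnW // ltnS /q leq_divRL // mulnC.
have qL : (2 ^ (q * k.+1) <= 2 ^ L)%N by rewrite leq_exp2l // leq_trunc_div.
apply: leq_trans qL; rewrite expnM.
apply: (@leq_trans (q.+1 ^ k.+1)); last by rewrite leq_exp2r // ltn_expl.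
apply: (@leq_trans (C * (q.+1 * (k + 3)) ^ k)).
  rewrite leq_mul2l; apply/orP; right.
  by case: (k) Lq => [|k'] Lq; rewrite ?expn0 // leq_exp2r.
by rewrite expnMn mulnCA expnS mulnC leq_mul2r Cq orbT.
Qed.

Lemma polylog_le (C k : nat) :
  exists N, forall n, (N <= n)%N -> (C * (trunc_log 2 n + 2) ^ k <= n)%N.
Proof.
have [L0 HL] := poly_lt_exp2 C k; exists (2 ^ L0)%N => n le_n.
have n0 : (0 < n)%N by apply: leq_trans le_n; rewrite expn_gt0.
apply: leq_trans (trunc_logP (isT : (1 < 2)%N) n0); apply: HL.
by apply: trunc_log_max.
Qed.

Section HarmonicBound.
Variable R : realType.

Lemma le_harmonic_sum (M N : nat) : (M <= N)%N -> harmonic_sum R M <= harmonic_sum R N.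
Proof.
move=> MN; have [M0|M1] := leqP M 1.
  by rewrite /harmonic_sum [leLHS]big_geq // sumr_ge0.
rewrite /harmonic_sum [leRHS](big_cat_nat _ (n := M)) //=; last exact: ltnW.
by rewrite lerDl sumr_ge0.
Qed.

(** Each dyadic block from [2^m] to [2^(m+1)] contributes at most 1. *)
Lemma harmonic_sum_exp2 m : harmonic_sum R (2 ^ m) <= m%:R.
Proof.
elim: m => [|m IH]; first by rewrite /harmonic_sum big_geq.
rewrite /harmonic_sum (big_cat_nat _ (n := 2 ^ m)) ?expn_gt0 //=; last by rewrite leq_exp2l.
rewrite -natr1 lerD //.
apply: (@le_trans _ _ (\sum_(2 ^ m <= l < 2 ^ m.+1) ((2 ^ m)%:R^-1 : R))).
  apply: ler_sum_nat => l /andP[ml _]; rewrite lef_pV2 ?posrE ?ltr0n ?expn_gt0 //.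
    by rewrite ler_nat.
  by rewrite (leq_trans _ ml) // expn_gt0.
by rewrite sumr_const_nat expnS mul2n -addnn addnK -[leLHS]mulr_natr mulVf.
Qed.

Lemma harmonic_sum_trunc_log n : (0 < n)%N ->
  harmonic_sum R (n + n) <= (trunc_log 2 n + 2)%:R.
Proof.
move=> n0; apply: le_trans (harmonic_sum_exp2 _); apply: le_harmonic_sum.
rewrite addnn -muln2 addn2 expnSr leq_mul2r /= ltnW //.
by apply: trunc_log_ltn.
Qed.

Lemma harmonic_sum_ge1 n : (0 < n)%N -> 1 <= harmonic_sum R (n + n).
Proof.
move=> n0; apply: le_trans (le_harmonic_sum (_ : (2 <= n + n)%N)); last by lia.
by rewrite /harmonic_sum big_nat1 invr1.
Qed.

End HarmonicBound.

(** * Lower limits in the extended reals *)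

Section LowerLimit.
Variables (R : realType) (T : choiceType) (X : filteredType T).
Implicit Types (f : X -> \bar R) (F : set_system X).

Lemma limf_einf_gt f F (y : \bar R) : Filter F ->
  (y < limf_einf f F)%E -> F [set x | (y < f x)%E].
Proof.
move=> FF; rewrite limf_einfE => /ereal_sup_gt[_ [V FV <-]] yV.
apply: filterS FV => x Vx; apply: (lt_le_trans yV).
by apply: ereal_inf_lbound; exists x.
Qed.

Lemma le_limf_einf f F (y : \bar R) :
  F [set x | (y <= f x)%E] -> (y <= limf_einf f F)%E.
Proof.
move=> Fy; rewrite limf_einfE.
apply: (@le_trans _ _ (ereal_inf [set f x | x in [set x | (y <= f x)%E]])).
  by apply/ereal_infP => _ [x yx <-].
by apply: ereal_sup_ubound; exists [set x | (y <= f x)%E].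
Qed.

End LowerLimit.

(** Reduces the limit inequality to real approximations from below; an infinite [x] or [y] admits
    arbitrarily large ones, which forces [z] to be infinite. *)
Lemma lee_add_of_lt (R : realType) (x y z : \bar R) :
  x != -oo%E -> y != -oo%E ->
  (forall a b e : R, (a%:E < x)%E -> (b%:E < y)%E -> 0 < e -> ((a + b - e)%:E <= z)%E) ->
  (x + y <= z)%E.
Proof.
case: x => [x| |] //; case: y => [y| |] // _ _ H.
- case: z H => [z| |] H; rewrite ?leey //.
    rewrite -EFinD lee_fin leNgt; apply/negP => zxy.
    pose e := (x + y - z) / 4; have e0 : 0 < e by rewrite /e; lra.
    have := H (x - e) (y - e) e; rewrite !lte_fin lee_fin => /(_ _ _ e0).
    by rewrite !gtrBl e0 => /(_ isT isT); rewrite /e; lra.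
  by have := H (x - 1) (y - 1) 1; rewrite !lte_fin !gtrBl ltr01 => /(_ isT isT isT).
- case: z H => [z| |] H; rewrite ?leey //.
    (* The witnesses are chosen so that the sum minus 1 is [z + 1]. *)
    have := H (x - 1) (z - x + 3) 1; rewrite !lte_fin !gtrBl ltr01 ltry lee_fin => /(_ isT isT isT).
    by move=> h; exfalso; move: h; clear H; lra.
  by have := H (x - 1) 1 1; rewrite !lte_fin !gtrBl ltr01 ltry => /(_ isT isT isT).
- case: z H => [z| |] H; rewrite ?leey //.
    have := H (z - y + 3) (y - 1) 1; rewrite !lte_fin !gtrBl ltr01 ltry lee_fin => /(_ isT isT isT).
    by move=> h; exfalso; move: h; clear H; lra.
  by have := H 1 (y - 1) 1; rewrite !lte_fin !gtrBl ltr01 ltry => /(_ isT isT isT).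
- case: z H => [z| |] H; rewrite ?leey //.
    have := H (z + 2) 0 1; rewrite !ltry ltr01 lee_fin => /(_ isT isT isT).
    by move=> h; exfalso; move: h; clear H; lra.
  by have := H 1 1 1; rewrite ltr01 !ltry => /(_ isT isT isT).
Qed.

(* [l] balances the two halves of the AM-GM error term of [invr_merit_ge_perturb]. *)
Lemma perturb_real_bound (R : realType) (a b eps u v X H t ni : R) :
  0 < eps -> 1 <= H -> 0 <= t <= 1 -> a <= u -> 0 <= u + 1 -> b <= X ->
  ni <= eps / 4 -> 2 * (`|a| + 1) * (1 - t) <= eps / 4 ->
  H ^+ 4 * (1 - t) <= eps ^+ 2 / 512 ^+ 2 ->
  (forall l, 0 < l ->
    (u + 1) * t ^+ 2 + X - ni - 128 * H ^+ 2 * (l + (1 - t) / l) <= v + 1) ->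
  a + b - eps <= v.
Proof.
move=> e0 H1 /andP[t0 t1] au u0 bX hn ht hH hl.
have H0 : 0 < H by lra.
(* With this [l] the first half of the error is exactly [eps / 4], and the bound with [512 ^+ 2]
   makes the second at most [eps / 4]. *)
have l0 : 0 < eps / (512 * H ^+ 2).
  by apply: divr_gt0 e0 (mulr_gt0 _ _); [exact: ltr0Sn|exact: exprn_gt0].
have := hl _ l0.
have -> : 128 * H ^+ 2 * (eps / (512 * H ^+ 2) + (1 - t) / (eps / (512 * H ^+ 2)))
   = eps / 4 + 256 ^+ 2 / eps * (H ^+ 4 * (1 - t)).
  by field; rewrite !gt_eqF.
have h1 : 256 ^+ 2 / eps * (H ^+ 4 * (1 - t)) <= eps / 4.
  have -> : eps / 4 = 256 ^+ 2 / eps * (eps ^+ 2 / 512 ^+ 2) by field; rewrite gt_eqF.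
  by apply: ler_wpM2l hH; apply: divr_ge0 (ltW e0); exact/exprn_ge0/ler0n.
(* As [t^2 >= 1 - 2 (1 - t)], the change of normalisation costs at most [2 (|a| + 1) (1 - t)]; for
   negative [a + 1] the right side is already large enough. *)
have h2 : a + 1 - eps / 4 <= (u + 1) * t ^+ 2.
  have [a1|a1] := leP 0 (a + 1).
    have : (a + 1) * t ^+ 2 <= (u + 1) * t ^+ 2 by rewrite ler_wpM2r ?sqr_ge0 ?lerD2r.
    have aN : a + 1 <= `|a| + 1 by rewrite lerD2r ler_norm.
    have : (a + 1) * (2 * (1 - t)) <= (`|a| + 1) * (2 * (1 - t)) by rewrite ler_wpM2r //; lra.
    have : 0 <= (a + 1) * (1 - t) ^+ 2 by rewrite mulr_ge0 ?sqr_ge0.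
    nra.
  have : 0 <= (u + 1) * t ^+ 2 by rewrite mulr_ge0 ?sqr_ge0.
  lra.
lra.
Qed.

(** * Estimates valid for all large n *)

Section Eventually.
Variables (R : realType) (r : R).

(** With [L] of order [log n], the harmonic sum and the number of primes of [n] are at most [L], so
    the product is at most [L^5 / p]. Cubing gives [L^15 / p^3], where [p^3 >= n / C] beats any
    power of [L]. *)
Lemma totient_defect_small (C : nat) (eta : R) : 0 < eta ->
  exists N, forall n, (N <= n)%N -> (1 < n)%N -> (n <= C * pdiv n ^ 3)%N ->
    harmonic_sum R (n + n) ^+ 4 * (1 - (totient n)%:R / n%:R) <= eta.
Proof.
move=> eta0; have [N HN] := polylog_le (C * (Num.truncn (eta^-1 ^+ 3)).+1) 15.
exists N => n Nn n1 nC; have n0 := ltnW n1; set p := pdiv n in nC *.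
have p0 : (0 < p)%N by exact: pdiv_gt0.
set L := (trunc_log 2 n + 2)%N.
have wL : (size (primes n) <= L)%N.
  apply: leq_trans (_ : (trunc_log 2 n <= _)%N); last by rewrite leq_addr.
  by apply: trunc_log_max => //; exact: leq_exp2_primes.
have n0' : (0 : R) < n%:R by rewrite ltr0n.
have p0' : (0 : R) < p%:R by rewrite ltr0n.
have defect : 1 - (totient n)%:R / n%:R <= L%:R / p%:R :> R.
  have := leq_totient_primes n1; rewrite -/p -(ler_nat R) natrD natrM => h.
  have np : (n %/ p)%:R * p%:R = n%:R :> R by rewrite -natrM divnK // pdiv_dvd.
  have hw : (size (primes n))%:R * (n %/ p)%:R <= L%:R * (n %/ p)%:R :> R.
    by rewrite ler_wpM2r // ler_nat.
  rewrite ler_pdivlMr // -(ler_pM2r n0').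
  have -> : (1 - (totient n)%:R / n%:R) * p%:R * n%:R = (n%:R - (totient n)%:R) * p%:R :> R.
    by field; rewrite gt_eqF.
  by rewrite -np mulrA ler_wpM2r //; rewrite -np in h hw *; lra.
have H0 : 0 <= harmonic_sum R (n + n) by apply: le_trans (harmonic_sum_ge1 R n0).
have HL : harmonic_sum R (n + n) ^+ 4 <= L%:R ^+ 4.
  by rewrite lerXn2r ?nnegrE // harmonic_sum_trunc_log.
apply: (@le_trans _ _ (L%:R ^+ 4 * (L%:R / p%:R))).
  apply: ler_pM => //; first by rewrite exprn_ge0.
  by rewrite subr_ge0 ler_pdivrMr // mul1r ler_nat totient_leq.
rewrite mulrA -exprSr ler_pdivrMr //.
rewrite -(ler_pXn2r (n := 3)) ?nnegrE ?mulr_ge0 ?exprn_ge0 ?(ltW eta0) ?(ltW p0') //.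
rewrite -exprM exprMn.
have key : (L ^ 15 * (Num.truncn (eta^-1 ^+ 3)).+1 <= p ^ 3)%N.
  have C0 : (0 < C)%N by case: (C) nC => //; rewrite mul0n leqNgt n0.
  rewrite -(leq_pmul2l C0); apply: leq_trans nC.
  by rewrite mulnA mulnAC; exact: HN.
move: key; rewrite -(ler_nat R) natrM !natrX => key.
have e3 : 0 < eta ^+ 3 by rewrite exprn_gt0.
have tr : (eta ^+ 3)^-1 <= (Num.truncn (eta^-1 ^+ 3)).+1%:R.
  by rewrite -exprVn ltW // truncnS_gt.
have : L%:R ^+ 15 * (eta ^+ 3)^-1 <= p%:R ^+ 3.
  by apply: le_trans key; rewrite ler_wpM2l // exprn_ge0.
by rewrite ler_pdivrMr // mulrC.
Qed.

Lemma invr_merit_eventually (a b eps : R) : 0 < eps ->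
  exists N, forall n, (N <= n)%N -> [&& odd n, squarefree n & (1 < n)%N] ->
    a <= (merit (rotp n r (charJ R n)))^-1 ->
    b <= n%:R / (2 * (pdiv n)%:R ^+ 3) ->
    a + b - eps <= (merit (rotp n r (charJ R n) + rotp n r (polyV R n)))^-1.
Proof.
move=> e0.
(* If [n > C p^3] then [n / (2 p^3) - 1 >= M - 1 > a + b], so the peaks alone suffice; otherwise [p]
   is at least of order [n^(1/3)]. *)
pose M := `|a| + `|b| + 2; pose C := (Num.truncn (2 * M)).+1.
have a0 := normr_ge0 a; have b0 := normr_ge0 b.
(* The first bound controls the AM-GM error, the second the change of normalisation, as
   [1 - t <= H ^+ 4 * (1 - t)]. *)
pose eta := Num.min (eps ^+ 2 / 512 ^+ 2) (eps / (8 * (`|a| + 1))).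
have eta0 : 0 < eta.
  rewrite lt_min; apply/andP; split; apply: divr_gt0.
  - exact: exprn_gt0.
  - exact/exprn_gt0/ltr0Sn.
  - exact: e0.
  - by apply: mulr_gt0; lra.
have [N1 HN1] := totient_defect_small C eta0.
pose N2 := (Num.truncn (4 / eps)).+1.
exists (maxn N1 N2) => n; rewrite geq_max => /andP[nN1 nN2] /and3P[on sf n1] ha hb.
have n0 := ltnW n1; set p := pdiv n in hb *.
have n0' : (0 : R) < n%:R by rewrite ltr0n.
have p0' : (0 : R) < p%:R by rewrite ltr0n pdiv_gt0.
have [nC|nC] := leqP n (C * p ^ 3).
  have dH := HN1 n nN1 n1 nC.
  have H1 := harmonic_sum_ge1 R n0.
  set H := harmonic_sum R (n + n) in dH H1.
  set t : R := (totient n)%:R / n%:R in dH.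
  have t01 : 0 <= t <= 1 by rewrite divr_ge0 //= ler_pdivrMr // mul1r ler_nat totient_leq.
  have H4 : 1 <= H ^+ 4 by rewrite exprn_ege1.
  have d1 : 1 - t <= eta.
    apply: le_trans dH; case/andP: t01 => t0 t1; nra.
  move: dH d1; rewrite /eta !le_min => /andP[dH _] /andP[_ d1].
  apply: (@perturb_real_bound R a b eps (merit (rotp n r (charJ R n)))^-1 _
    (n%:R / (2 * p%:R ^+ 3)) H t n%:R^-1) => //.
  - rewrite (invr_merit_charJ r n1) subrK divr_ge0 ?sqr_ge0 //.
    by rewrite mulr_ge0 ?invr_ge0 // sumr_ge0 // => k _; rewrite exprn_ge0 ?abs_circ_ge0.
  - rewrite -[eps / 4]invrK lef_pV2 ?posrE ?invr_gt0 ?divr_gt0 // invf_div.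
    apply: (@le_trans _ _ N2%:R); last by rewrite ler_nat.
    by rewrite ltW // truncnS_gt.
  - have a8 : 0 < 8 * (`|a| + 1) by apply: mulr_gt0; lra.
    have -> : 2 * (`|a| + 1) * (1 - t) = (1 - t) * (8 * (`|a| + 1)) / 4 by field.
    by rewrite ler_pM2r // -ler_pdivlMr.
  - by move=> l; exact: invr_merit_ge_perturb.
have npr : ~~ prime n.
  apply: contraTN nC => pn; rewrite -leqNgt /p pdiv_id //.
  by rewrite -[X in (X <= _)%N]mul1n leq_mul // -[X in (X <= _)%N]expn1 leq_exp2l.
have := invr_merit_ge_peaks r n1 on sf npr; rewrite -/p; apply: le_trans.
have : M <= n%:R / (2 * p%:R ^+ 3).
  have p3 : (0 : R) < 2 * p%:R ^+ 3 by rewrite mulr_gt0 // exprn_gt0.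
  rewrite ler_pdivlMr // mulrA [M * 2]mulrC.
  apply: (@le_trans _ _ (C%:R * p%:R ^+ 3)).
    by rewrite ler_wpM2r ?exprn_ge0 // ltW // truncnS_gt.
  by rewrite -natrX -natrM ler_nat ltnW.
have := ler_norm a; have := ler_norm b; rewrite /M; lra.
Qed.

End Eventually.

Theorem theorem3 (R : realType) (S : set nat) (r : R) :
  infinite_set S ->
  (forall n, S n -> [&& odd n, squarefree n & (1 < n)%N]) ->
  (limf_einf (fun n : nat => ((merit (rotp n r (charJ R n) + rotp n r (polyV R n)))^-1)%:E)
     (within S \oo)
   >= limf_einf (fun n : nat => ((merit (rotp n r (charJ R n)))^-1)%:E) (within S \oo)
      + limf_einf (fun n : nat => (n%:R / (2 * (pdiv n)%:R ^+ 3) : R)%:E) (within S \oo))%E.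
Proof.
move=> _ HS.
have FS : Filter (within S \oo) by exact: within_filter.
(* Both lower limits on the right stay above [-oo]: the reciprocal merit factor of the rotated J is
   at least [-1], and [n / (2 p^3)] is nonnegative. *)
have gtNy (f : nat -> R) (y : R) : (forall n, S n -> y <= f n) ->
    (limf_einf (fun n => (f n)%:E) (within S \oo) != -oo)%E.
  move=> yf; rewrite -ltNye; apply: lt_le_trans (ltNyr y) _.
  by apply: le_limf_einf; apply: nearW => n Sn /=; rewrite lee_fin yf.
apply: lee_add_of_lt.
- apply: (gtNy _ (-1)) => n /HS /and3P[on sf n1].
  rewrite (invr_merit_charJ r n1) -[leLHS]add0r lerD2r divr_ge0 ?sqr_ge0 //.
  by rewrite mulr_ge0 ?invr_ge0 // sumr_ge0 // => k _; rewrite exprn_ge0 ?abs_circ_ge0.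
- by apply: (gtNy _ 0) => n _; rewrite divr_ge0 // mulr_ge0 // exprn_ge0.
move=> a b e /limf_einf_gt aF /limf_einf_gt bF e0.
have [N HN] := invr_merit_eventually r a b e0.
have FN : within S \oo [set n | (N <= n)%N /\ S n].
  have : (\forall n \near \oo, (N <= n)%N) by exact: nbhs_infty_ge.
  by apply: filterS => n Nn Sn; split.
apply: le_limf_einf; apply: (@filterS _ (within S \oo) FS _ _ _ (filterI FN (filterI aF bF))).
move=> n [[Nn Sn] []] /=.
rewrite !lte_fin lee_fin => /ltW an /ltW bn.
exact: HN Nn (HS n Sn) an bn.
Qed.
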